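(* There is an absolute constant $C$ such that the following holds. Let $d\ge3$, $\tau\in S_d$, let $r_1=1$, let $R\in\mathbb N_+$ satisfy $\min\{n_{\tau(1)},n_{\tau(d)}\}\ge R$ and $\min_{2\le j\le d-1} n_{\tau(j)}\ge R^2>\max_{2\le j\le d} r_j\ge\min_{2\le j\le d} r_j\ge R$, and let $\vec{\mathbf u}\in\mathcal U^d_{\vec r,\vec n,\tau}$. Suppose there is a constant $\sigma>0$ such that for any $i_1,i_2,i_3\in\{1,\dots,d\}$ for which $(i_1,i_2,i_3)$ is of the correct order with respect to $\tau$ and any $y_i\in\{1,\dots,n_i\}$, $i\in\{1,\dots,d\}\setminus\{i_1,i_2,i_3\}$, the matrix $M_{i_2,(i_1,i_3)}\in\mathbb R^{n_{i_2}\times(n_{i_1}n_{i_3})}$ formed from $\varphi(\vec{\mathbf u},\tau)$ satisfies $\sigma_{R^2}(M_{i_2,(i_1,i_3)})\ge\sigma$. Suppose that each observation of an entry of $\mathbf T=\varphi(\vec{\mathbf u},\tau)$ is contaminated by additive noise distributed as $\mathcal N(0,\sigma_e^2)$, $\sigma_e>0$, independently across observations. Let $n_{\max}=\max_{1\le i\le d} n_i$. Then for any $T<\frac{\sigma}{\sigma_e}$, the probability that the Train Recovery Algorithm, run with the integer $R$ and the noisy observations, returns an incorrect ordering (i.e. does not return an element of $\mathcal CS^d_{\mathrm{TT}}(\tau)$) is smaller than or equal to $$C\,d\log d\cdot\exp\left(-\tfrac18\max\{T-2n_{\max}-2\sqrt{n_{\max}},0\}^2\right).$$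
   Context: **Tensor train format.** $d$ is a positive integer, $S_d$ is the group of permutations of $\{1,\dots,d\}$, and $\vec n=(n_1,\dots,n_d)$, $\vec r=(r_1,\dots,r_d)$ are vectors of positive integers with $r_1=1$; subscripts of $r$ are read modulo $d$ (so $r_{d+1}=r_1=1$). For $\tau\in S_d$ let $\mathcal U^d_{\vec r,\vec n,\tau}=\bigoplus_{i=1}^d\mathbb R^{r_{\tau^{-1}(i)}\times n_i\times r_{\tau^{-1}(i)+1}}$. For $\vec{\mathbf u}=(\mathbf u^{[1]},\dots,\mathbf u^{[d]})$ in it, write $\mathbf u^{[i]}(x)=\mathbf u^{[i]}(:,x,:)\in\mathbb R^{r_{\tau^{-1}(i)}\times r_{\tau^{-1}(i)+1}}$. The tensor $\varphi(\vec{\mathbf u},\tau)\in\mathbb R^{n_1\times\cdots\times n_d}$ has entries (the $1\times1$ matrix product) $$\varphi(\vec{\mathbf u},\tau)(x_1,\dots,x_d)=\mathbf u^{[\tau(1)]}(x_{\tau(1)})\,\mathbf u^{[\tau(2)]}(x_{\tau(2)})\cdots\mathbf u^{[\tau(d)]}(x_{\tau(d)}).$$ **Equivalence class.** $\mathcal CS^d_{\mathrm{TT}}(\tau)=\{\tau,\tau\circ\beta\}$, where $\beta(j)=d+1-j$. **Correct order.** For distinct $i_1,i_2,i_3\in\{1,\dots,d\}$, $(i_1,i_2,i_3)$ is of the correct order with respect to $\tau$ if $\tau^{-1}(i_1)<\tau^{-1}(i_2)<\tau^{-1}(i_3)$ or $\tau^{-1}(i_3)<\tau^{-1}(i_2)<\tau^{-1}(i_1)$.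 **Matricizations.** Given distinct $i_1,i_2,i_3$ and fixed $y_i\in\{1,\dots,n_i\}$ for $i\notin\{i_1,i_2,i_3\}$, let $A(x_{i_1},x_{i_2},x_{i_3})$ be the entry of the tensor whose $i_s$-th coordinate is $x_{i_s}$ ($1\le s\le3$) and whose $i$-th coordinate is $y_i$ for all other $i$. Define $M_{i_1,(i_2,i_3)}\in\mathbb R^{n_{i_1}\times(n_{i_2}n_{i_3})}$, $M_{i_2,(i_3,i_1)}\in\mathbb R^{n_{i_2}\times(n_{i_3}n_{i_1})}$, $M_{i_3,(i_1,i_2)}\in\mathbb R^{n_{i_3}\times(n_{i_1}n_{i_2})}$ by $M_{i_1,(i_2,i_3)}(x_{i_1},(x_{i_2},x_{i_3}))=M_{i_2,(i_3,i_1)}(x_{i_2},(x_{i_3},x_{i_1}))=M_{i_3,(i_1,i_2)}(x_{i_3},(x_{i_1},x_{i_2}))=A(x_{i_1},x_{i_2},x_{i_3})$. Likewise $M_{i_2,(i_1,i_3)}(x_{i_2},(x_{i_1},x_{i_3}))=A(x_{i_1},x_{i_2},x_{i_3})$, which is $M_{i_2,(i_3,i_1)}$ up to a reordering of columns. $\sigma_k(M)$ denotes the $k$-th largest singular value of $M$, with $\sigma_k(M)=0$ if $k$ exceeds the smaller dimension of $M$. **Three-Index Algorithm.** Input: $i_1,i_2,i_3$, an integer $R\in\mathbb N_+$, and an oracle for the entries of $\mathbf T$. Sample $y_i\in\{1,\dots,n_i\}$ for $i\notin\{i_1,i_2,i_3\}$ (in any way independent of the noise); form the three matrices $M_{i_1,(i_2,i_3)},M_{i_2,(i_3,i_1)},M_{i_3,(i_1,i_2)}$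 from the (here noisy) observed entries of $\mathbf T$. Compare $a=\sigma_{R^2}(M_{i_1,(i_2,i_3)})$, $b=\sigma_{R^2}(M_{i_2,(i_3,i_1)})$, $c=\sigma_{R^2}(M_{i_3,(i_1,i_2)})$. If $a>\max\{b,c\}$ return $(i_2,i_1,i_3)$; if $b>\max\{a,c\}$ return $(i_1,i_2,i_3)$; if $c>\max\{a,b\}$ return $(i_2,i_3,i_1)$. (If there is a tie and no case applies, this is counted as an incorrect output, and the whole recovery is counted as incorrect.) **Train Recovery Algorithm.** Input: $R\in\mathbb N_+$ and an oracle for the entries of $\mathbf T$; every call to the Three-Index Algorithm makes its own observations. 1. Let $(i_1,i_2,i_3)$ be the output of the Three-Index Algorithm on $1,2,3$. 2. For $t=3,\dots,d-1$: set $j_{\min}=0$, $j_{\max}=t+1$. While $j_{\max}-j_{\min}\ge2$: (i) if $j_{\max}-j_{\min}\ge3$, set $j_1=j_{\min}+\lfloor\frac13(j_{\max}-j_{\min})\rfloor$, $j_2=j_{\min}+\lfloor\frac23(j_{\max}-j_{\min})\rfloor$; else if $j_{\min}\ge1$, set $j_1=j_{\min}$, $j_2=j_{\min}+1$; else set $j_1=1$, $j_2=2$; (ii) run the Three-Index Algorithm on $t+1,i_{j_1},i_{j_2}$; if its output is $(t+1,i_{j_1},i_{j_2})$ or $(i_{j_2},i_{j_1},t+1)$, set $j_{\max}=j_1$; else if it is $(i_{j_1},t+1,i_{j_2})$ or $(i_{j_2},t+1,i_{j_1})$, set $j_{\min}=j_1$, $j_{\max}=j_2$; else set $j_{\min}=j_2$.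 After the while loop, replace $(i_1,\dots,i_t)$ by $(i_1,\dots,i_{j_{\min}},t+1,i_{j_{\max}},\dots,i_t)$ (the part before $t+1$ is empty if $j_{\min}=0$, the part after is empty if $j_{\max}=t+1$). 3. Return $\tau'\in S_d$ with $\tau'(j)=i_j$ for $1\le j\le d$. *)

(* Defs.v *)
From HB Require Import structures.
From mathcomp Require Import all_boot all_order all_algebra all_fingroup.
From mathcomp Require Import polyrcf.
From mathcomp Require Import all_classical all_reals all_analysis.

Set Implicit Arguments.
Unset Strict Implicit.
Unset Printing Implicit Defensive.

Import Order.TTheory GRing.Theory Num.Theory.

Local Open Scope classical_set_scope.
Local Open Scope ring_scope.

(* Indices, positions and bonds 1, ..., d are represented by 0, ..., d-1 in
   'I_d: k stands for k+1.  In particular r_1 is the value of r at 0. *)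

(* Multi-indices (x_1, ..., x_d). *)
Definition mindex (d : nat) (n : 'I_d -> nat) : finType :=
  {dffun forall i : 'I_d, 'I_(n i)}.

(** ** Singular values *)

Section SingularValues.
Variable R : realType.

(* Real eigenvalues, repeated according to algebraic multiplicity. *)
Definition eigenvalues (m : nat) (A : 'M[R]_m) : seq R :=
  flatten [seq nseq (mup x (char_poly A)) x | x <- rootsR (char_poly A)].

Definition singular_values (m p : nat) (M : 'M[R]_(m, p)) : seq R :=
  sort (fun x y => y <= x) [seq Num.sqrt x | x <- eigenvalues (M *m M^T)].

(* sigma_k(M) for k >= 1.  The list above has m entries, those after the p-th
   being 0 when m > p, so this is 0 as soon as k > min(m, p). *)
Definition singular_value (k m p : nat) (M : 'M[R]_(m, p)) : R :=
  nth 0 (singular_values M) k.-1.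

End SingularValues.

(** ** Tensor train format *)

Section TensorTrain.
Variables (R : realType) (d : nat).
Variables (r n : 'I_d -> nat) (tau : 'S_d).

(* ordS is the cyclic successor, so r (ordS j) is r_{j+1} with the subscript
   read modulo d. *)
Definition tt_cores : Type :=
  forall i : 'I_d, 'I_(n i) -> 'M[R]_(r (tau^-1 i)%g, r (ordS (tau^-1 i)%g)).

Lemma core_dims (j : 'I_d) :
  (r (tau^-1 (tau j))%g = r j) *
  (r (ordS (tau^-1 (tau j))%g) = r (ordS j)).
Proof. by rewrite permK. Qed.

Variables (hd : (0 < d)%N) (u : tt_cores) (x : mindex n).

(* The matrix u^[tau(j)](x_{tau(j)}). *)
Definition core_at (j : 'I_d) : 'M[R]_(r j, r (ordS j)) :=
  castmx (core_dims j) (u (x (tau j))).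

(* Product of the k successive factors starting at position j. *)
Fixpoint tt_chain (j : 'I_d) (k : nat) : 'M[R]_(r j, r (iter k (@ordS d) j)) :=
  match k with
  | 0 => 1%:M
  | k'.+1 => tt_chain j k' *m core_at (iter k' (@ordS d) j)
  end.

(* phi(u, tau)(x).  The product of all d factors has size r_1 x r_{d+1} = r_1 x r_1; conform_mx
   reads it as a 1 x 1 matrix, which is legitimate exactly when r_1 = 1. *)
Definition tt_entry : R :=
  conform_mx (0 : 'M[R]_1) (tt_chain (Ordinal hd) d) 0 0.

End TensorTrain.

Definition rev_perm (d : nat) : 'S_d := perm (@rev_ord_inj d).

(* In MathComp (s * t) i = t (s i), so rev_perm * tau is tau o beta. *)
Definition TT_class (d : nat) (tau : 'S_d) : {set 'S_d} :=
  [set tau; (rev_perm d * tau)%g]%SET.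

Definition correct_order (d : nat) (tau : 'S_d) (i1 i2 i3 : 'I_d) : bool :=
  let p i := (tau^-1 i)%g in
  ((p i1 < p i2 < p i3) || (p i3 < p i2 < p i1))%N.

(** ** Matricizations *)

Section Matricization.
Variables (R : realType) (d : nat) (n : 'I_d -> nat).

(* A (a, (b, c)) |-> F a b c matrix; pairs are enumerated by mxvec_index. *)
Definition unfold (p q s : nat) (F : 'I_p -> 'I_q -> 'I_s -> R) :
    'M[R]_(p, q * s) :=
  \matrix_(a < p) mxvec (\matrix_(b < q, c < s) F a b c).

(* A(x_{i1}, x_{i2}, x_{i3}): the coordinates i1, i2, i3 of y are overwritten,
   hence irrelevant. *)
Definition subtensor (T : mindex n -> R) (y : mindex n) (i1 i2 i3 : 'I_d)
    (a : 'I_(n i1)) (b : 'I_(n i2)) (c : 'I_(n i3)) : R :=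
  T (finfun (dfwith (dfwith (dfwith y i1 a) i2 b) i3 c)).

Variables (T : mindex n -> R) (y : mindex n) (i1 i2 i3 : 'I_d).
Let A := @subtensor T y i1 i2 i3.

Definition M1_23 : 'M[R]_(n i1, n i2 * n i3) := unfold A.
Definition M2_31 : 'M[R]_(n i2, n i3 * n i1) := unfold (fun b c a => A a b c).
Definition M3_12 : 'M[R]_(n i3, n i1 * n i2) := unfold (fun c a b => A a b c).
Definition M2_13 : 'M[R]_(n i2, n i1 * n i3) := unfold (fun b a c => A a b c).

End Matricization.

(** ** Algorithms *)

(* T is the tensor of observed entries; None encodes a tie. *)
Definition three_index (R : realType) (d : nat) (n : 'I_d -> nat) (Rk : nat)
    (T : mindex n -> R) (y : mindex n) (i1 i2 i3 : 'I_d) :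
    option ('I_d * 'I_d * 'I_d) :=
  let a := singular_value (Rk ^ 2) (M1_23 T y i1 i2 i3) in
  let b := singular_value (Rk ^ 2) (M2_31 T y i1 i2 i3) in
  let c := singular_value (Rk ^ 2) (M3_12 T y i1 i2 i3) in
  if Num.max b c < a then Some (i2, i1, i3)
  else if Num.max a c < b then Some (i1, i2, i3)
  else if Num.max a b < c then Some (i2, i3, i1)
  else None.

Section TrainRecovery.
Variable d : nat.

(* call k i1 i2 i3 is the output of the Three-Index Algorithm on i1, i2, i3
   when this is the k-th call (k = 0, 1, ...) of the run; the counter k is
   threaded through so that each call can be given its own observations. *)
Variable call : nat -> 'I_d -> 'I_d -> 'I_d -> option ('I_d * 'I_d * 'I_d).

(* The pair (j_1, j_2). *)
Definition probes (jmin jmax : nat) : nat * nat :=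
  let m := (jmax - jmin)%N in
  if (3 <= m)%N then (jmin + m %/ 3, jmin + (2 * m) %/ 3)%N
  else if (1 <= jmin)%N then (jmin, jmin.+1)
  else (1, 2)%N.

(* The while loop locating the new index t in the current list s.  j_min and
   j_max are kept 1-based (i_j is nth t s j.-1).  jmax - jmin decreases
   strictly at each iteration, so any fuel >= jmax - jmin lets the loop run to
   its end.  Returns the next call number and the final (jmin, jmax), or None
   if a call ended in a tie. *)
Fixpoint locate (s : seq 'I_d) (t : 'I_d) (fuel k jmin jmax : nat) :
    option (nat * nat * nat) :=
  match fuel with
  | 0 => Some (k, jmin, jmax)
  | fuel'.+1 =>
    if (2 <= jmax - jmin)%N then
      let: (j1, j2) := probes jmin jmax in
      let p := nth t s j1.-1 in
      let q := nth t s j2.-1 in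
      if call k t p q is Some out then
        if (out == (t, p, q)) || (out == (q, p, t)) then
          locate s t fuel' k.+1 jmin j1
        else if (out == (p, t, q)) || (out == (q, t, p)) then
          locate s t fuel' k.+1 j1 j2
        else locate s t fuel' k.+1 j2 jmax
      else None
    else Some (k, jmin, jmax)
  end.

(* ts lists the indices still to be inserted, and val t (counted from 0) is the
   number of indices already ordered when t is inserted.  A wrong call may
   leave jmin = jmax; an index is then repeated, and stays so. *)
Fixpoint insert_all (ts : seq 'I_d) (k : nat) (s : seq 'I_d) :
    option (seq 'I_d) :=
  match ts with
  | [::] => Some s
  | t :: ts' =>
    if locate s t t.+1 k 0 t.+1 is Some (k', jmin, jmax) then
      insert_all ts' k' (take jmin s ++ t :: drop jmax.-1 s)
    else None
  end.

(* enum 'I_d lists the indices in increasing order. *)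
Definition train_list : option (seq 'I_d) :=
  match enum 'I_d with
  | a :: b :: c :: ts =>
    if call 0 a b c is Some (i1, i2, i3)
    then insert_all ts 1 [:: i1; i2; i3] else None
  | _ => None
  end.

(* The permutation j |-> i_j; None after a tie, or if (i_j) is not an
   enumeration of all the indices. *)
Definition train_recovery : option 'S_d :=
  if train_list is Some s then [pick t : 'S_d | codom t == s] else None.

End TrainRecovery.

(** ** Noise *)

Section Noise.
Variables (R : realType) (disp : measure_display) (Omega : measurableType disp).
Variable P : probability Omega R.

Definition mutually_independent (I : eqType) (X : I -> {RV P >-> R}) : Prop :=
  forall (s : seq I) (B : I -> set R), uniq s ->
    (forall i, measurable (B i)) ->
    P (\big[setI/setT]_(i <- s) (X i @^-1` B i)) =
    (\prod_(i <- s) P (X i @^-1` B i))%E.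

(* Independent N(0, s^2) variables. *)
Definition iid_normal (I : eqType) (s : R) (X : I -> {RV P >-> R}) : Prop :=
  mutually_independent X /\
  forall (i : I) (B : set R), measurable B ->
    P (X i @^-1` B) = normal_prob 0 s B.

(* A family Y of random variables with values in a finite type, which is as a
   whole independent of the family X: sigma(Y) and sigma(X) are independent. *)
Definition independent_of_noise (I : Type) (X : I -> {RV P >-> R})
    (J : Type) (F : finType) (Y : J -> Omega -> F) : Prop :=
  (forall j y, measurable (Y j @^-1` [set y])) /\
  forall A B : set Omega,
    <<s [set A' | exists j y, A' = Y j @^-1` [set y]] >> A ->
    <<s [set B' | exists i D, measurable D /\ B' = X i @^-1` D] >> B ->
    P (A `&` B) = (P A * P B)%E.

Variables (d : nat) (n : 'I_d -> nat).

(* Output of a run on the tensor T.  The entry x observed during the k-th call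
   is T x + noise (k, x) (the three matrices of one call are formed from the
   same observations); y (k, i1, i2, i3) is the multi-index sampled by that
   call if its input is i1, i2, i3. *)
Definition noisy_recovery (Rk : nat) (T : mindex n -> R)
    (noise : nat * mindex n -> {RV P >-> R})
    (y : nat * ('I_d * 'I_d * 'I_d) -> Omega -> mindex n)
    (w : Omega) : option 'S_d :=
  train_recovery (fun k i1 i2 i3 =>
    three_index Rk (fun x => T x + noise (k, x) w)
      (y (k, (i1, i2, i3)) w) i1 i2 i3).

Definition incorrect (tau : 'S_d) (out : option 'S_d) : bool :=
  if out is Some tau' then tau' \notin TT_class tau else true.

End Noise.

(* Main.v *)
(** A bond of size less than [R^2] factors the matricization of an extreme index
of a triple, so without noise its [R^2]-th singular value is [0], while that of
the middle index is at least [sigma].  A call of the Three-Index Algorithm can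
therefore err only if an extreme noise matrix has operator norm greater than
[sigma_e * S], or the [R^2 x R^2] compression of the middle noise matrix to the
leading singular subspaces has operator norm greater than [sigma_e * S'], where
[S + S' = T].  The second matrix is much smaller than the first, so the uneven
splitting of [T] in which [S] exceeds [S'] by [N] (here [N = n_max]) leaves a
slack of order [N] in each estimate; this pays for a crude grid net combined
with the tail [exp (- (s - sqrt l)^2 / 2)] of the norm of a Gaussian vector of
dimension [l], and sharp Gaussian concentration is not needed.  The calls made
by an error-free run do not depend on the noise, so a union bound over these
O(d log d) calls suffices, after conditioning on the sampled coordinates. *)
Require Import Defs.
From HB Require Import structures.
From mathcomp Require Import all_boot all_order all_algebra all_fingroup.
From mathcomp Require Import polyrcf.
From mathcomp Require Import all_classical all_reals all_analysis.
From mathcomp Require Import measurable_realfun.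
From mathcomp Require Import complex spectral.
From mathcomp Require Import zify ring lra.

Set Implicit Arguments.
Unset Strict Implicit.
Unset Printing Implicit Defensive.

Import Order.TTheory GRing.Theory Num.Theory.
Import numFieldNormedType.Exports.

Local Open Scope classical_set_scope.
Local Open Scope ring_scope.

(** Put [t = T - 2 * N - 2 * sqrt N]; the target exponent [t ^+ 2 / 8] is [(t / 2) ^+ 2 / 2]. The
    image of a unit vector has typical length at most [N] under an extreme noise matrix and at most
    [sqrt N] under the compressed middle one, in units of [sigma_e]. Beyond this length and [t / 2],
    the splitting of [T] leaves a surplus of at least [N / 2] on each side. Half of [N / 2] covers
    the mesh of the net; the other half enters the exponent, where it outweighs the logarithm of the
    size of the net up to a constant.

    The independence of the noise is given on product events only, so Gaussian estimates are derived
    from moment generating functions of linear forms, obtained by integrating out one variable at a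
    time.

    The sampled coordinates are independent of the sigma-algebra of the noise, so the bad events
    must belong to that sigma-algebra; this is why they are explicit finite unions over a net.

    Betweenness does not see orientation: an error-free run ends in one of the two orders of the
    class, and the first triple decides which. *)

Section LayerCake.
Context d (T : measurableType d) (R : realType).
Variable m : {sigma_finite_measure set T -> \bar R}.
Local Notation leb := (@lebesgue_measure R).

(** Tonelli on the region between 0 and the graph of [F]. The weight [Z] later carries the other
    factors of a product of random variables. *)
Lemma layer_cake (Z : T -> \bar R) (F : T -> R) :
  measurable_fun setT Z -> (forall x, 0 <= Z x)%E ->
  measurable_fun setT F -> (forall x, 0 <= F x) ->
  (\int[m]_x (Z x * (F x)%:E) =
   \int[leb]_(u in `[0%R, +oo[) \int[m]_(x in [set x | (u < F x)%R]) Z x)%E.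
Proof.
move=> mZ Z0 mF F0.
pose A : set (T * R) := [set p | 0 <= p.2] `&` [set p | p.2 < F p.1].
have mA : measurable A.
  apply: measurableI.
    have -> : [set p : T * R | 0 <= p.2] = snd @^-1` `[0, +oo[%classic.
      by apply/seteqP; split => p /=; rewrite in_itv/= andbT.
    rewrite -[_ @^-1` _]setTI.
    exact: (@measurable_snd _ _ T (measurableTypeR R)).
  have -> : [set p : T * R | p.2 < F p.1] =
            [set: T * R] `&` (fun p : T * R => F p.1 - p.2) @^-1` `]0, +oo[%classic.
    by apply/seteqP; split => p /=; rewrite in_itv/= andbT subr_gt0; tauto.
  have mf : measurable_fun setT (fun p : T * measurableTypeR R => F p.1 - p.2).
    by apply: measurable_funB => //; apply: measurableT_comp.
  exact: mf.
pose G (p : T * R) : \bar R := (Z p.1 * (\1_A p)%:E)%E.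
have mG : measurable_fun setT (G : T * measurableTypeR R -> \bar R).
  apply: emeasurable_funM.
    by apply: measurableT_comp.
  apply/measurable_EFinP; exact: measurable_indic.
have G0 p : (0 <= G p)%E by rewrite /G mule_ge0 ?lee_fin.
have e1 x : (\int[leb]_u G (x, u) = Z x * (F x)%:E)%E.
  rewrite /G /= ge0_integralZl//; first last.
  - apply/measurable_EFinP.
    have -> : (fun u : measurableTypeR R => \1_A (x, u) : R) = \1_(`[0, F x[%classic).
      apply/funext => u; rewrite !indicE; congr (_%:R); congr (nat_of_bool _).
      by apply/idP/idP; rewrite !inE /A/= in_itv/= => /andP.
    exact: measurable_indic.
  congr (_ * _)%E.
  transitivity (\int[leb]_(u in `[0%R, F x[) (1%R)%:E)%E.
    rewrite [RHS]integral_mkcond; apply: eq_integral => u _.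
    rewrite /patch indicE; have -> // : ((x, u) \in A) = (u \in `[0, F x[%classic).
      by apply/idP/idP; rewrite !inE /A/= in_itv/= => /andP.
    by case: ifP.
  rewrite integral_cst//= mul1e lebesgue_measure_itv/= lte_fin.
  have := F0 x; rewrite le_eqVlt => /orP[/eqP <-|->].
    by rewrite ltxx.
  by rewrite oppr0 adde0.
under eq_integral do rewrite -e1.
rewrite (fubini_tonelli _ mG G0).
rewrite [RHS]integral_mkcond; apply: eq_integral => u _.
rewrite /patch; case: ifPn => [|]; rewrite (inE, notin_setE)/= in_itv/= andbT => u0.
  rewrite [RHS]integral_mkcond; apply: eq_integral => x _.
  rewrite /patch /G indicE/=.
  have -> : ((x, u) \in A) = (x \in [set x | u < F x]).
    by apply/idP/idP; rewrite !inE /A/=; [case|move=> h; split].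
  by case: ifP; rewrite ?mule1 ?mule0.
apply: integral0_eq => x _; rewrite /G indicE memNset ?mule0//.
by rewrite /A/= => -[].
Qed.

End LayerCake.

Section DensityTransfer.
Context d (T : measurableType d) (R : realType).
Variable m : {sigma_finite_measure set T -> \bar R}.
Local Notation leb := (@lebesgue_measure R).

(** By the layer cake formula both sides are integrals over [u] of the masses of the sets [f > u],
    to which the assumed density identity applies. With [Z] a product of other random factors this
    integrates out [X] alone, without a joint law. *)
Lemma ge0_integral_density (X : T -> R) (Z : T -> \bar R) (g : R -> \bar R)
    (f : R -> R) :
  measurable_fun setT X ->
  measurable_fun setT Z -> (forall x, 0 <= Z x)%E ->
  measurable_fun setT g -> (forall x, 0 <= g x)%E ->
  measurable_fun setT f -> (forall x, 0 <= f x) ->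
  (forall B, measurable B ->
     \int[m]_(x in X @^-1` B) Z x = \int[leb]_(r in B) g r)%E ->
  (\int[m]_x (Z x * (f (X x))%:E) = \int[leb]_r (g r * (f r)%:E))%E.
Proof.
move=> mX mZ Z0 mg g0 mf f0 h.
rewrite (layer_cake m mZ Z0 (measurableT_comp mf mX)); last by move=> x; exact: f0.
rewrite (layer_cake leb mg g0 mf f0).
apply: eq_integral => u _.
rewrite -h; first by [].
rewrite -[X in measurable X]setTI.
have -> : [set x | u < f x] = f @^-1` `]u, +oo[%classic.
  by apply/seteqP; split => x /=; rewrite in_itv/= andbT.
exact: mf.
Qed.

End DensityTransfer.

(** * Gaussian moment generating functions and the tail of a Gaussian norm *)

Section NormalIntegrals.
Variable R : realType.
Local Notation leb := (@lebesgue_measure R).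

(** Exponential tilting: completing the square turns the integrand into a multiple of the normal
    density with mean [s ^+ 2 * c]. *)
Lemma integral_expR_normal_pdf (s c : R) : 0 < s ->
  (\int[leb]_r ((normal_pdf 0 s r)%:E * (expR (c * r))%:E) =
   (expR (s ^+ 2 * c ^+ 2 / 2))%:E)%E.
Proof.
move=> s0.
transitivity (\int[leb]_r ((expR (s ^+ 2 * c ^+ 2 / 2))%:E *
    (normal_pdf (s ^+ 2 * c) s r)%:E))%E.
  apply: eq_integral => r _; rewrite -!EFinM; congr EFin.
  rewrite !normal_pdfE ?gt_eqF// [RHS]mulrCA -[LHS]mulrA; congr (_ * _).
  rewrite /normal_fun -!expRD; congr expR.
  have s1 : s != 0 by rewrite gt_eqF.
  by field.
rewrite ge0_integralZl//.
- by rewrite integral_normal_pdf mule1.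
- by apply/measurable_EFinP; exact: measurable_normal_pdf.
- by move=> r _; rewrite lee_fin normal_pdf_ge0.
Qed.

(** The integrand is a multiple of the centred normal density of variance [1 / (1 - t)]. *)
Lemma integral_expR_sqr_normal_pdf (t : R) : 0 <= t -> t < 1 ->
  (\int[leb]_r ((normal_pdf 0 1 r)%:E * (expR (t * r ^+ 2 / 2))%:E) =
   ((Num.sqrt (1 - t))^-1)%:E)%E.
Proof.
move=> t0 t1.
pose s := (Num.sqrt (1 - t))^-1.
have t1' : 0 < 1 - t by rewrite subr_gt0.
have s0 : 0 < s by rewrite invr_gt0 sqrtr_gt0.
have s2 : s ^+ 2 = (1 - t)^-1 by rewrite /s exprVn sqr_sqrtr// ltW.
transitivity (\int[leb]_r (s%:E * (normal_pdf 0 s r)%:E))%E.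
  apply: eq_integral => r _; rewrite -!EFinM; congr EFin.
  rewrite !normal_pdfE ?gt_eqF//.
  rewrite [RHS]mulrA /normal_peak /normal_fun -[LHS]mulrA -expRD; congr (_ * expR _).
    rewrite -[s ^+ 2 * pi *+ 2]mulrnAr sqrtrM ?sqr_ge0// sqrtr_sqr gtr0_norm//.
    by rewrite expr1n mul1r invfM mulVKf ?gt_eqF.
  rewrite s2; have ? : 1 - t != 0 by rewrite gt_eqF.
  by field.
rewrite ge0_integralZl//.
- by rewrite integral_normal_pdf mule1.
- by apply/measurable_EFinP; exact: measurable_normal_pdf.
- by move=> r _; rewrite lee_fin normal_pdf_ge0.
- by rewrite lee_fin ltW.
Qed.

End NormalIntegrals.

Section NormalFamily.
Context (R : realType) d (T : measurableType d) (P : probability T R).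
Variables (I : eqType) (sigma : R) (X : I -> {RV P >-> R}).
Hypothesis sigma0 : 0 < sigma.
Hypothesis iidX : iid_normal sigma X.
Local Notation leb := (@lebesgue_measure R).

Lemma measurable_prod_expR (s : seq I) (c : I -> R) :
  measurable_fun setT (fun w => \prod_(i <- s) expR (c i * X i w)).
Proof.
apply: measurable_prod => i _; apply: measurableT_comp => //.
by apply: measurable_funM.
Qed.

Lemma measurable_bigsetI (s : seq I) (B : I -> set R) :
  (forall i, measurable (B i)) ->
  measurable (\big[setI/setT]_(i <- s) (X i @^-1` B i)).
Proof.
move=> mB; elim: s => [|i s IH]; rewrite ?big_nil ?big_cons//.
apply: measurableI => //; rewrite -[_ @^-1` _]setTI.
exact: (measurable_funP (X i)).
Qed.

(** The events indexed by [s2] strengthen the induction. To integrate out [X i], its weighted law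
    must be known on every measurable [A]; this is the induction hypothesis with [i] moved to [s2]
    and carrying the event [A]. *)
Let normal_mgf_aux (s1 s2 : seq I) (c : I -> R) (B : I -> set R) :
  uniq (s1 ++ s2) -> (forall i, measurable (B i)) ->
  (\int[P]_(w in \big[setI/setT]_(i <- s2) (X i @^-1` B i))
     (\prod_(i <- s1) expR (c i * X i w))%:E =
   (\prod_(i <- s1) expR (sigma ^+ 2 * c i ^+ 2 / 2))%:E *
   \prod_(i <- s2) P (X i @^-1` B i))%E.
Proof.
elim: s1 s2 B => [|i s1 IH] s2 B us mB.
  under eq_integral do rewrite big_nil.
  rewrite integral_cst ?mul1e ?big_nil ?mul1e; last exact: measurable_bigsetI.
  exact: iidX.1.
pose D := \big[setI/setT]_(i <- s2) (X i @^-1` B i).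
have mD : measurable D by exact: measurable_bigsetI.
pose Z w := ((\prod_(i <- s1) expR (c i * X i w))%:E * (\1_D w)%:E)%E.
pose K := ((\prod_(i <- s1) expR (sigma ^+ 2 * c i ^+ 2 / 2))%:E *
   \prod_(i <- s2) P (X i @^-1` B i))%E.
have K0 : (0 <= K)%E.
  apply: mule_ge0; first by rewrite lee_fin prodr_ge0// => j _; exact: expR_ge0.
  by apply: prode_ge0 => j _; exact: measure_ge0.
transitivity (\int[P]_w (Z w * (expR (c i * X i w))%:E))%E.
  rewrite integral_mkcond; apply: eq_integral => w _.
  rewrite /patch /Z indicE; case: ifP => _; last by rewrite mule0 mul0e.
  by rewrite mule1 big_cons EFinM muleC.
rewrite (@ge0_integral_density _ _ _ P (X i) Z
  (fun r => K * (normal_pdf 0 sigma r)%:E)%E (fun r => expR (c i * r))) //.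
- under eq_integral do rewrite -muleA.
  rewrite ge0_integralZl//.
  + by rewrite integral_expR_normal_pdf// big_cons EFinM muleC muleA.
  + apply: emeasurable_funM; apply/measurable_EFinP.
      exact: measurable_normal_pdf.
    by apply: measurableT_comp => //; exact: measurable_funM.
  + by move=> r _; rewrite mule_ge0// lee_fin ?normal_pdf_ge0 ?expR_ge0.
- apply: emeasurable_funM; apply/measurable_EFinP; first exact: measurable_prod_expR.
  exact: measurable_indic.
- move=> w; rewrite mule_ge0// lee_fin//.
  by apply: prodr_ge0 => j _; exact: expR_ge0.
- apply: emeasurable_funM => //; apply/measurable_EFinP.
  exact: measurable_normal_pdf.
- by move=> r; rewrite mule_ge0// lee_fin normal_pdf_ge0.
- by apply: measurableT_comp => //; exact: measurable_funM.
move=> A mA.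
have nis : i \notin s2.
  by move: us; rewrite /= mem_cat negb_or => /andP[/andP[]].
have uc : uniq (s1 ++ i :: s2).
  by rewrite (uniq_catCA s1 [:: i] s2).
have := IH (i :: s2) (fun j => if j == i then A else B j) uc.
rewrite !big_cons eqxx.
have E (S : Type) (idx : S) (op : S -> S -> S) (F : I -> set R -> S) :
  \big[op/idx]_(j <- s2) F j (if j == i then A else B j) =
  \big[op/idx]_(j <- s2) F j (B j).
  apply: eq_big_seq => j js; case: eqP => // ji.
  by rewrite ji (negbTE nis) in js.
rewrite (E _ _ _ (fun j S => X j @^-1` S)) (E _ _ _ (fun j S => P (X j @^-1` S))).
move=> H; rewrite ge0_integralZl//; last 2 first.
- by apply/measurable_EFinP/measurable_funTS; exact: measurable_normal_pdf.
- by move=> r _; rewrite lee_fin normal_pdf_ge0.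
rewrite -[X in (_ * X)%E]/(normal_prob 0 sigma A) -(iidX.2 i)//.
rewrite /K -muleA [(_ * P _)%E]muleC -H; last by move=> j; case: ifP.
rewrite integral_mkcondr; apply: eq_integral => w _.
by rewrite /Z patchE indicE; case: ifP; rewrite ?mule1 ?mule0.
Qed.

Lemma normal_mgf_prod (s : seq I) (c : I -> R) : uniq s ->
  (\int[P]_w (\prod_(i <- s) expR (c i * X i w))%:E =
   (\prod_(i <- s) expR (sigma ^+ 2 * c i ^+ 2 / 2))%:E)%E.
Proof.
move=> us; have := @normal_mgf_aux s [::] c (fun=> setT).
rewrite cats0 !big_nil mule1; apply => //.
Qed.

Lemma normal_mgf (J : finType) (phi : J -> I) (c : J -> R) : injective phi ->
  (\int[P]_w (expR (\sum_j c j * X (phi j) w))%:E =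
   (expR (sigma ^+ 2 * (\sum_j c j ^+ 2) / 2))%:E)%E.
Proof.
move=> iphi.
pose s := [seq phi j | j <- enum J].
pose c' i := if [pick j | phi j == i] is Some j then c j else 0.
have c'E j : c' (phi j) = c j.
  rewrite /c'; case: pickP => [k /eqP/iphi ->//|/(_ j)]; by rewrite eqxx.
have us : uniq s by rewrite map_inj_uniq ?enum_uniq.
have := normal_mgf_prod c' us.
have E (F : I -> R -> R) : \prod_(i <- s) F i (c' i) = \prod_j F (phi j) (c j).
  by rewrite big_map big_enum/=; apply: eq_bigr => j _; rewrite c'E.
rewrite (E (fun _ r => expR (sigma ^+ 2 * r ^+ 2 / 2))).
under eq_integral do rewrite (E (fun i r => expR (r * X i _))).
rewrite -expR_sum mulr_sumr mulr_suml => <-.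
by apply: eq_integral => w _; rewrite -expR_sum.
Qed.

End NormalFamily.

Section ChiMgf.
Context (R : realType) d (T : measurableType d) (P : probability T R).
Variables (J : finType) (v : J -> T -> R).
Hypothesis mv : forall j, measurable_fun setT (v j).
Local Notation leb := (@lebesgue_measure R).

Let measurable_lin (h : J -> R) : measurable_fun setT (fun w => \sum_j h j * v j w).
Proof. by apply: measurable_sum => j; exact: measurable_funM. Qed.

(* [expR (t * v ^+ 2 / 2)] is the average of [expR (Num.sqrt t * r * v)] over a
   standard normal [r]; Tonelli then removes the squares one at a time. *)
Let chi_mgf_aux (t : R) (s : seq J) (h : J -> R) :
  0 <= t -> t < 1 ->
  (forall h : J -> R, (\int[P]_w (expR (\sum_j h j * v j w))%:E <=
     (expR ((\sum_j h j ^+ 2) / 2))%:E)%E) ->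
  uniq s -> (forall j, j \in s -> h j = 0) ->
  (\int[P]_w (expR (\sum_j h j * v j w + \sum_(j <- s) t * v j w ^+ 2 / 2))%:E <=
   (expR ((\sum_j h j ^+ 2) / 2) * (Num.sqrt (1 - t))^-1 ^+ size s)%:E)%E.
Proof.
move=> t0 t1 Hv; elim: s h => [|j s IH] h us hs.
  under eq_integral do rewrite big_nil addr0.
  by rewrite expr0 mulr1.
move: us => /= /andP[js us].
have hj : h j = 0 by apply: hs; rewrite mem_head.
(* The linearised square of [v j] occupies the slot [j] of the linear form, which is still free
   since [h j = 0]. It adds [t * r ^+ 2] to the squared norm of the coefficients, and averaging over
   [r] yields one factor [(Num.sqrt (1 - t))^-1]. *)
pose h' (r : R) k := if k == j then Num.sqrt t * r else h k.
have h's r k : k \in s -> h' r k = 0.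
  move=> ks; rewrite /h'; case: eqP => [kj|_]; first by rewrite -kj ks in js.
  by rewrite hs// inE ks orbT.
have sumh' (r : R) w : \sum_k h' r k * v k w =
    \sum_k h k * v k w + Num.sqrt t * v j w * r.
  rewrite (bigD1 j)//= [in RHS](bigD1 j)//= /h' eqxx hj mul0r add0r addrC.
  rewrite mulrAC; congr (_ + _); apply: eq_bigr => k kj; by rewrite (negbTE kj).
have sumh'2 r : \sum_k h' r k ^+ 2 = \sum_k h k ^+ 2 + t * r ^+ 2.
  rewrite (bigD1 j)//= [in RHS](bigD1 j)//= /h' eqxx hj expr0n/= add0r addrC.
  rewrite exprMn sqr_sqrtr//; congr (_ + _); apply: eq_bigr => k kj.
  by rewrite (negbTE kj).
pose F (p : T * R) : \bar R := ((normal_pdf 0 1 p.2)%:E *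
  (expR (\sum_k h' p.2 k * v k p.1 + \sum_(k <- s) t * v k p.1 ^+ 2 / 2))%:E)%E.
have F0 p : (0 <= F p)%E.
  by rewrite mule_ge0// lee_fin ?normal_pdf_ge0 ?expR_ge0.
have mF : measurable_fun setT (F : T * measurableTypeR R -> \bar R).
  apply: emeasurable_funM; apply/measurable_EFinP.
    by apply: measurableT_comp; [exact: measurable_normal_pdf|].
  apply: measurableT_comp => //; apply: measurable_funD.
    have -> : (fun x : T * R => \sum_k h' x.2 k * v k x.1) =
       (fun x => \sum_k h k * v k x.1 + Num.sqrt t * v j x.1 * x.2).
      by apply/funext => x; rewrite sumh'.
    apply: measurable_funD.
      by apply: (measurableT_comp (measurable_lin h)).
    apply: measurable_funM => //; apply: measurable_funM => //.
    exact: (measurableT_comp (mv j)).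
  apply: measurable_sum => k; do 2 apply: measurable_funM => //.
  by apply: measurable_funX; exact: (measurableT_comp (mv k)).
rewrite [leLHS](_ : _ = \int[P]_w \int[leb]_r F (w, r))%E; last first.
  apply: eq_integral => w _; rewrite /F /=.
  rewrite big_cons addrCA expRD addrC EFinM.
  have {1}-> : t * v j w ^+ 2 / 2 = 1 ^+ 2 * (Num.sqrt t * v j w) ^+ 2 / 2.
    by rewrite expr1n mul1r exprMn sqr_sqrtr.
  rewrite -integral_expR_normal_pdf// muleC -ge0_integralZl//.
  - apply: eq_integral => r _.
    rewrite muleCA; congr (_ * _)%E; rewrite -EFinM -expRD sumh'.
    congr (expR _)%:E; ring.
  - apply: emeasurable_funM; apply/measurable_EFinP.
      exact: measurable_normal_pdf.
    by apply: measurableT_comp => //; exact: measurable_funM.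
  - by move=> r _; rewrite mule_ge0// lee_fin ?normal_pdf_ge0 ?expR_ge0.
rewrite (fubini_tonelli _ mF F0).
pose K := expR ((\sum_k h k ^+ 2) / 2) * (Num.sqrt (1 - t))^-1 ^+ size s.
have K0 : 0 <= K by rewrite mulr_ge0 ?expR_ge0// exprn_ge0// invr_ge0.
apply: (@le_trans _ _ (\int[leb]_r (K%:E *
   ((normal_pdf 0 1 r)%:E * (expR (t * r ^+ 2 / 2))%:E)))%E); last first.
  rewrite ge0_integralZl//.
  - rewrite integral_expR_sqr_normal_pdf// -EFinM lee_fin /K -mulrA.
    by rewrite -exprSr.
  - apply: emeasurable_funM; apply/measurable_EFinP.
      exact: measurable_normal_pdf.
    apply: measurableT_comp => //; do 2 apply: measurable_funM => //.
  - by move=> r _; rewrite mule_ge0// lee_fin ?normal_pdf_ge0 ?expR_ge0.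
apply: ge0_le_integral => //.
- by move=> r _; apply: integral_ge0.
- exact: (measurable_fun_fubini_tonelli_G _ mF F0).
- apply: emeasurable_funM => //; apply: emeasurable_funM; apply/measurable_EFinP.
    exact: measurable_normal_pdf.
  apply: measurableT_comp => //; do 2 apply: measurable_funM => //.
move=> r _; rewrite /F/= ge0_integralZl//; first last.
- by rewrite lee_fin normal_pdf_ge0.
- apply/measurable_EFinP; apply: measurableT_comp => //; apply: measurable_funD.
    exact: measurable_lin.
  apply: measurable_sum => k; do 2 apply: measurable_funM => //.
  exact: measurable_funX.
rewrite muleCA lee_wpmul2l// ?lee_fin ?normal_pdf_ge0//.
apply: (le_trans (IH (h' r) us (h's r))).
rewrite lee_fin sumh'2 mulrDl expRD /K mulrAC.
by rewrite lexx.
Qed.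

(** Assuming only a sub-Gaussian bound on all linear forms lets the lemma apply directly to the
    image of a vector under a compressed noise matrix, with no appeal to the rotation invariance of
    the Gaussian law. *)
Lemma chi_mgf (t : R) :
  0 <= t -> t < 1 ->
  (forall h : J -> R, (\int[P]_w (expR (\sum_j h j * v j w))%:E <=
     (expR ((\sum_j h j ^+ 2) / 2))%:E)%E) ->
  (\int[P]_w (expR (t * (\sum_j v j w ^+ 2) / 2))%:E <=
   ((Num.sqrt (1 - t))^-1 ^+ #|J|)%:E)%E.
Proof.
move=> t0 t1 Hv.
have := @chi_mgf_aux t (enum J) (fun=> 0) t0 t1 Hv (enum_uniq _) (fun _ _ => erefl).
rewrite -cardE [\sum_j 0 ^+ 2]big1 => [|j _]; last by rewrite expr0n.
rewrite mul0r expR0 mul1r.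
apply: le_trans; rewrite le_eqVlt; apply/orP; left; apply/eqP.
apply: eq_integral => w _; rewrite [\sum_j 0 * _]big1 ?add0r; last first.
  by move=> j _; rewrite mul0r.
by rewrite big_enum mulr_sumr mulr_suml.
Qed.

End ChiMgf.

Section ChiTail.
Context (R : realType) d (T : measurableType d) (P : probability T R).
Variables (J : finType) (v : J -> T -> R).
Hypothesis mv : forall j, measurable_fun setT (v j).

(* Markov's inequality with the exponent optimised at [t = 1 - #|J| / s ^+ 2]. *)
Lemma chi_tail (k s : R) : 0 < k ->
  (forall h : J -> R, (\int[P]_w (expR (\sum_j h j * v j w))%:E <=
     (expR (k ^+ 2 * (\sum_j h j ^+ 2) / 2))%:E)%E) ->
  (0 < #|J|)%N -> Num.sqrt #|J|%:R <= s ->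
  (P [set w | ((k * s) ^+ 2 < \sum_j v j w ^+ 2)%R] <=
   (expR (- ((s - Num.sqrt #|J|%:R) ^+ 2 / 2)))%:E)%E.
Proof.
move=> k0 Hv l0 ls.
set q := Num.sqrt #|J|%:R in ls *.
have q0 : 0 < q by rewrite sqrtr_gt0 ltr0n.
have q2 : q ^+ 2 = #|J|%:R by rewrite sqr_sqrtr.
have s0 : 0 < s by exact: lt_le_trans ls.
pose t := 1 - q ^+ 2 / s ^+ 2.
have t1 : t < 1 by rewrite ltrBlDr ltrDl divr_gt0 ?exprn_gt0.
have t0 : 0 <= t.
  by rewrite subr_ge0 ler_pdivrMr ?exprn_gt0// mul1r ler_pXn2r// nnegrE ltW.
have V0 w : 0 <= \sum_j v j w ^+ 2 by apply: sumr_ge0 => j _; exact: sqr_ge0.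
pose f w := expR (t * (\sum_j (v j w / k) ^+ 2) / 2).
have mf : measurable_fun setT f.
  apply: measurableT_comp => //; apply: measurable_funM => //.
  apply: measurable_funM => //; apply: measurable_sum => j.
  by apply: measurable_funX; exact: measurable_funM.
set A := [set w | _].
have mA : measurable A.
  have -> : A = [set: T] `&` (fun w => \sum_j v j w ^+ 2) @^-1` `](k * s) ^+ 2, +oo[%classic.
    by apply/seteqP; split => w; rewrite /A /= in_itv/= andbT; tauto.
  have : measurable_fun setT (fun w => \sum_j v j w ^+ 2).
    by apply: measurable_sum => j; exact: measurable_funX.
  exact.
have H : (\int[P]_w (f w)%:E <= ((Num.sqrt (1 - t))^-1 ^+ #|J|)%:E)%E.
  have mv' j : measurable_fun setT (fun w => v j w / k) by exact: measurable_funM.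
  apply: (chi_mgf mv' t0 t1) => h.
  have := Hv (fun j => h j / k).
  rewrite (_ : k ^+ 2 * _ = \sum_j h j ^+ 2); last first.
    rewrite mulr_sumr; apply: eq_bigr => j _; have ? : k != 0 by rewrite gt_eqF.
    by field.
  move=> {}Hv; apply: le_trans Hv.
  rewrite le_eqVlt; apply/orP; left; apply/eqP.
  by apply: eq_integral => w _; congr (expR _)%:E; apply: eq_bigr => j _; ring.
have step : ((expR (t * s ^+ 2 / 2))%:E * P A <= \int[P]_w (f w)%:E)%E.
  have -> : ((expR (t * s ^+ 2 / 2))%:E * P A =
      \int[P]_w ((expR (t * s ^+ 2 / 2))%:E * (\1_A w)%:E))%E.
    rewrite ge0_integralZl//; first by rewrite integral_indic// setIT.
    by apply/measurable_EFinP; exact: measurable_indic.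
  apply: ge0_le_integral => //.
  - by apply: emeasurable_funM => //; apply/measurable_EFinP; exact: measurable_indic.
  - by apply/measurable_EFinP.
  move=> w _; rewrite indicE; case: (boolP (w \in A)); last first.
    by rewrite mule0 lee_fin expR_ge0.
  rewrite inE /A/= mule1 lee_fin => Aw.
  rewrite ler_expR ler_pM2r ?invr_gt0// ler_wpM2l//.
  have -> : \sum_j (v j w / k) ^+ 2 = (\sum_j v j w ^+ 2) / k ^+ 2.
    by rewrite mulr_suml; apply: eq_bigr => j _; rewrite exprMn exprVn.
  by rewrite ler_pdivlMr ?exprn_gt0// -exprMn mulrC ltW.
have {H} := le_trans step H.
rewrite muleC -lee_pdivlMr ?expR_gt0// => /le_trans; apply.
rewrite -EFinM lee_fin -expRN.
have -> : 1 - t = (q / s) ^+ 2 by rewrite /t exprMn exprVn; ring.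
rewrite sqrtr_sqr gtr0_norm ?divr_gt0// invf_div.
(* Since [#|J| = q ^+ 2], the total exponent becomes [q * (s - q) - (s ^+ 2 - q ^+ 2) / 2], which is
   exactly [- (s - q) ^+ 2 / 2]. *)
have : (s / q) ^+ #|J| <= expR (s / q - 1) ^+ #|J|.
  apply: lerXn2r; rewrite ?nnegrE ?expR_ge0//; first by rewrite divr_ge0// ltW.
  by apply: le_trans (expR_ge1Dx _); rewrite addrC subrK.
rewrite -expRM_natl => h.
apply: le_trans (ler_wpM2r (expR_ge0 _) h) _.
rewrite -expRD ler_expR -q2 /t le_eqVlt; apply/orP; left; apply/eqP.
have ? : s != 0 by rewrite gt_eqF.
have ? : q != 0 by rewrite gt_eqF.
by field; apply/andP.
Qed.

End ChiTail.

(** * Euclidean norm of row vectors and matrices with orthonormal rows *)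

Section EuclideanNorm.
Variable R : realType.

Definition sqn (n : nat) (x : 'rV[R]_n) : R := \sum_j x 0 j ^+ 2.
Definition nrm (n : nat) (x : 'rV[R]_n) : R := Num.sqrt (sqn x).

Lemma sqn_ge0 n (x : 'rV[R]_n) : 0 <= sqn x.
Proof. by apply: sumr_ge0 => j _; exact: sqr_ge0. Qed.

Lemma nrm_ge0 n (x : 'rV[R]_n) : 0 <= nrm x.
Proof. exact: sqrtr_ge0. Qed.

Lemma nrm_sqr n (x : 'rV[R]_n) : nrm x ^+ 2 = sqn x.
Proof. by rewrite sqr_sqrtr ?sqn_ge0. Qed.

Lemma sqnE n (x : 'rV[R]_n) : sqn x = (x *m x^T) 0 0.
Proof. by rewrite mxE; apply: eq_bigr => j _; rewrite mxE -expr2. Qed.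

Lemma sqn_eq0 n (x : 'rV[R]_n) : (sqn x == 0) = (x == 0).
Proof.
apply/idP/eqP => [/eqP h|->]; last first.
  by apply/eqP; apply: big1 => j _; rewrite mxE expr0n.
apply/rowP => j; rewrite mxE; apply/eqP; rewrite -sqrf_eq0; apply/eqP.
by move: h => /psumr_eq0P; apply => // i _; exact: sqr_ge0.
Qed.

Lemma sqn_gt0 n (x : 'rV[R]_n) : (0 < sqn x) = (x != 0).
Proof. by rewrite lt0r sqn_eq0 sqn_ge0 andbT. Qed.

Lemma nrm_gt0 n (x : 'rV[R]_n) : (0 < nrm x) = (x != 0).
Proof. by rewrite sqrtr_gt0 sqn_gt0. Qed.

Lemma nrm0 n : nrm (0 : 'rV[R]_n) = 0.
Proof. by apply/eqP; rewrite sqrtr_eq0 le_eqVlt sqn_eq0 eqxx. Qed.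

Lemma sqnZ n (a : R) (x : 'rV[R]_n) : sqn (a *: x) = a ^+ 2 * sqn x.
Proof. by rewrite /sqn mulr_sumr; apply: eq_bigr => j _; rewrite mxE exprMn. Qed.

Lemma nrmZ n (a : R) (x : 'rV[R]_n) : nrm (a *: x) = `|a| * nrm x.
Proof. by rewrite /nrm sqnZ sqrtrM ?sqr_ge0// sqrtr_sqr. Qed.

Lemma nrm_le n p (x : 'rV[R]_n) (y : 'rV[R]_p) a : 0 <= a ->
  (nrm x <= a * nrm y) = (sqn x <= a ^+ 2 * sqn y).
Proof.
by move=> a0; rewrite -!nrm_sqr -exprMn ler_pXn2r// nnegrE ?mulr_ge0 ?nrm_ge0.
Qed.

(** Multiplied by [y = \sum_i b i ^+ 2], the defect of the inequality is the sum of the squares of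
    [y * a i - z * b i]; if [y = 0] then [b] vanishes. *)
Lemma cauchy_schwarz (I : finType) (a b : I -> R) :
  (\sum_i a i * b i) ^+ 2 <= (\sum_i a i ^+ 2) * (\sum_i b i ^+ 2).
Proof.
pose x := \sum_i a i ^+ 2; pose y := \sum_i b i ^+ 2; pose z := \sum_i a i * b i.
have y0 : 0 <= y by apply: sumr_ge0 => i _; exact: sqr_ge0.
have h : 0 <= y * (x * y - z ^+ 2).
  have -> : y * (x * y - z ^+ 2) = \sum_i (y * a i - z * b i) ^+ 2.
    have -> : y * (x * y - z ^+ 2) = y ^+ 2 * x - (2 * y * z) * z + z ^+ 2 * y by ring.
    rewrite [y ^+ 2 * x]mulr_sumr [X in _ - X + _]mulr_sumr [z ^+ 2 * y]mulr_sumr.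
    by rewrite -sumrB -big_split/=; apply: eq_bigr => i _; ring.
  by apply: sumr_ge0 => i _; exact: sqr_ge0.
have [y_eq0|y_gt0] := eqVneq y 0; last first.
  by rewrite -subr_ge0; move: h; rewrite pmulr_rge0// lt0r y_gt0.
have b0 i : b i = 0.
  apply/eqP; rewrite -sqrf_eq0; apply/eqP.
  by move: y_eq0 => /psumr_eq0P; apply => // j _; exact: sqr_ge0.
rewrite big1 ?expr0n ?mulr_ge0 ?sumr_ge0// => [i _|i _|i _].
- by rewrite sqr_ge0.
- by rewrite sqr_ge0.
- by rewrite b0 mulr0.
Qed.

Lemma nrmD n (x y : 'rV[R]_n) : nrm (x + y) <= nrm x + nrm y.
Proof.
rewrite -(ler_pXn2r (n := 2)) ?nnegrE ?addr_ge0 ?nrm_ge0//.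
rewrite nrm_sqr sqrrD !nrm_sqr.
have -> : sqn (x + y) = sqn x + (\sum_j x 0 j * y 0 j) *+ 2 + sqn y.
  rewrite -mulr_natr mulr_suml /sqn -!big_split/=; apply: eq_bigr => j _.
  by rewrite mxE; ring.
rewrite lerD2r lerD2l ler_pMn2r//.
apply: le_trans (ler_norm _) _.
rewrite -(ler_pXn2r (n := 2)) ?nnegrE ?mulr_ge0 ?nrm_ge0//.
rewrite exprMn !nrm_sqr -normrX ger0_norm ?sqr_ge0//.
exact: cauchy_schwarz.
Qed.

Lemma nrmN n (x : 'rV[R]_n) : nrm (- x) = nrm x.
Proof. by rewrite -scaleN1r nrmZ normrN1 mul1r. Qed.

Lemma lerB_nrm n (x y : 'rV[R]_n) : nrm x - nrm y <= nrm (x + y).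
Proof.
by rewrite lerBlDr -(nrmN y) -{1}(addrK y x); exact: nrmD.
Qed.

(** A crude bound of the operator norm by the sum of the absolute values of the entries. It serves
    qualitative purposes only: finiteness of the operator norm and continuity of singular values. *)
Lemma nrm_mulmx_le m n (x : 'rV[R]_m) (E : 'M[R]_(m, n)) :
  nrm (x *m E) <= (\sum_i \sum_j `|E i j|) * nrm x.
Proof.
have L0 : 0 <= \sum_i \sum_j `|E i j| by do 2 apply: sumr_ge0 => ? _.
rewrite nrm_le//.
apply: (@le_trans _ _ (sqn x * \sum_j \sum_i E i j ^+ 2)).
  rewrite mulr_sumr; apply: ler_sum => j _; rewrite mxE.
  exact: cauchy_schwarz.
rewrite mulrC; apply: ler_wpM2r; first exact: sqn_ge0.
rewrite exchange_big/=.
have sqr_sum (I : finType) (a : I -> R) : (forall i, 0 <= a i) ->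
    \sum_i a i ^+ 2 <= (\sum_i a i) ^+ 2.
  move=> a0; rewrite expr2 mulr_suml; apply: ler_sum => i _.
  rewrite expr2 ler_wpM2l// (bigD1 i)//= lerDl; exact: sumr_ge0.
apply: le_trans (sqr_sum _ _ _); last by move=> i; exact: sumr_ge0.
apply: ler_sum => i _; apply: le_trans (sqr_sum _ _ _) => //.
rewrite le_eqVlt; apply/orP; left; apply/eqP.
by apply: eq_bigr => j _; rewrite real_normK ?num_real.
Qed.

Lemma sqn_mulmx_orth k n (y : 'rV[R]_k) (Q : 'M[R]_(k, n)) :
  Q *m Q^T = 1%:M -> sqn (y *m Q) = sqn y.
Proof. by move=> hQ; rewrite !sqnE trmx_mul -mulmxA [Q *m _]mulmxA hQ mul1mx. Qed.

Lemma nrm_mulmx_orth k n (y : 'rV[R]_k) (Q : 'M[R]_(k, n)) :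
  Q *m Q^T = 1%:M -> nrm (y *m Q) = nrm y.
Proof. by move=> hQ; rewrite /nrm sqn_mulmx_orth. Qed.

(** Pythagoras: [z *m V^T] are the coordinates of the projection of [z] to the row space of [V], and
    the defect is the squared norm of the residual. *)
Lemma nrm_mulmx_tr_orth k n (z : 'rV[R]_n) (V : 'M[R]_(k, n)) :
  V *m V^T = 1%:M -> nrm (z *m V^T) <= nrm z.
Proof.
move=> hV; rewrite -[leRHS]mul1r nrm_le// expr1n mul1r -subr_ge0.
have -> : sqn z - sqn (z *m V^T) = sqn (z - z *m V^T *m V).
  have mxB (A B : 'M[R]_1) : (A - B) 0 0 = A 0 0 - B 0 0 by rewrite !mxE.
  rewrite !sqnE -mxB [(_ - _)^T]raddfB/= !trmx_mul trmxK mulmxBr 2!mulmxBl.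
  set S := z *m V^T; rewrite -[S *m V *m z^T]mulmxA -[S *m V *m _]mulmxA.
  have -> : V *m (V^T *m (V *m z^T)) = V *m z^T.
    by rewrite mulmxA hV mul1mx.
  have -> : z *m (V^T *m (V *m z^T)) = S *m (V *m z^T) by rewrite mulmxA.
  by rewrite subrr subr0.
exact: sqn_ge0.
Qed.

End EuclideanNorm.

(** * Spectral theorem for real symmetric matrices *)

Section Spectral.
Variable R : realType.

(** Over the complex numbers the matrix is Hermitian, hence has a real eigenvalue. That eigenvalue
    is a root of the characteristic polynomial, and being a root descends to the real field, where
    it gives a real eigenvector. *)
Lemma symmetric_eigenvector n (A : 'M[R]_n.+1) : A^T = A ->
  exists a, exists2 v : 'rV[R]_n.+1, v != 0 & v *m A = a *: v.
Proof.
move=> symA; pose f := real_complex R.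
pose Ac := map_mx f A.
have hA : Ac \is hermsymmx.
  apply/is_hermitianmxP; rewrite expr0 scale1r; apply/matrixP => i j; rewrite !mxE.
  rewrite -[in LHS]symA mxE; apply/esym/CrealP; exact/complex_realP/(ex_intro _ (A j i)).
have spR := hermitian_spectral_diag_real hA.
have /orthomx_spectralP eA := hermitian_normalmx hA.
have uP := spectral_unit Ac.
set P := spectralmx Ac in eA uP.
have /mxOverP /(_ 0 0) /complex_realP [a ea] := spR.
have : eigenvalue Ac (f a).
  apply/eigenvalueP; exists (row 0 P).
    rewrite -row_mul {1}eA !mulmxA mulmxV// mul1mx.
    by rewrite row_mul row_diag_mx -scalemxAl -rowE ea.
  apply/negP => /eqP r0; have : row 0 P *m invmx P = 0 by rewrite r0 mul0mx.
  rewrite -row_mul mulmxV// row1 => /rowP /(_ 0); rewrite !mxE eqxx => /eqP.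
  by rewrite oner_eq0.
rewrite eigenvalue_root_char -map_char_poly fmorph_root -eigenvalue_root_char.
by case/eigenvalueP => v vA v0; exists a; exists v.
Qed.

(* [H] is the Householder reflection exchanging [u] and the first basis vector. *)
Lemma orthogonal_completion n (u : 'rV[R]_n.+1) : sqn u = 1 ->
  exists H : 'M[R]_n.+1, [/\ H^T = H, H *m H = 1%:M & delta_mx 0 0 *m H = u].
Proof.
move=> u1; pose e : 'rV[R]_n.+1 := delta_mx 0 0.
have [ue|ue] := eqVneq u e.
  by exists 1%:M; rewrite trmx1 !mulmx1 ue.
pose w := e - u; pose c := 2 / sqn w.
have w0 : sqn w != 0 by rewrite sqn_eq0 subr_eq0 eq_sym.
have e1 : (e *m e^T) 0 0 = 1 by rewrite trmx_delta mul_delta_mx mxE !eqxx.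
have uu : (u *m u^T) 0 0 = 1 by rewrite -sqnE.
have eu : (e *m u^T) 0 0 = (u *m e^T) 0 0.
  by rewrite -[e *m u^T]trmxK trmx_mul trmxK [LHS]mxE.
(* Both [e] and [u] are unit vectors; this identity is what makes the reflection along [w] send [e]
   to [u]. *)
have ww : sqn w = 2 * (e *m w^T) 0 0.
  have mxB (A B : 'M[R]_1) : (A - B) 0 0 = A 0 0 - B 0 0 by rewrite !mxE.
  rewrite sqnE /w [(_ - _)^T]raddfB/= 2!mulmxBr 2!mulmxBl !mxB e1 uu eu; ring.
have wwT : w *m w^T = (sqn w)%:M by rewrite [LHS]mx11_scalar -sqnE.
exists (1%:M - c *: (w^T *m w)); split.
- by rewrite linearB/= trmx1 linearZ/= trmx_mul trmxK.
- set X := c *: _.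
  have XX : X *m X = X + X.
    rewrite /X -scalemxAl -scalemxAr -mulmxA [w *m (_ *m _)]mulmxA wwT.
    rewrite mul_scalar_mx -scalemxAr !scalerA -scalerDl; congr (_ *: _).
    by rewrite /c; field.
  rewrite mulmxBl mul1mx [X *m (_ - _)]mulmxBr XX mulmx1.
  by rewrite opprB addrK subrK.
- rewrite mulmxBr mulmx1 -scalemxAr mulmxA [e *m w^T]mx11_scalar mul_scalar_mx scalerA.
  have -> : c * (e *m w^T) 0 0 = 1.
    by rewrite /c mulrAC -ww divff.
  by rewrite scale1r /w subKr.
Qed.

(** Deflation: a reflection carries a unit eigenvector to the first basis vector. The conjugated
    matrix is then block diagonal by symmetry, and the induction hypothesis diagonalises the
    remaining block. *)
Lemma real_spectral n (A : 'M[R]_n) : A^T = A ->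
  exists Q : 'M[R]_n, exists d : 'rV[R]_n,
    Q *m Q^T = 1%:M /\ Q *m A *m Q^T = diag_mx d.
Proof.
elim: n A => [|n IH] A symA.
  by exists 1%:M, 0; split; apply/matrixP => -[].
have [a [v v0 vA]] := symmetric_eigenvector symA.
pose u := (nrm v)^-1 *: v.
have nv : nrm v != 0 by rewrite gt_eqF ?nrm_gt0.
have u1 : sqn u = 1 by rewrite sqnZ -nrm_sqr -exprMn mulVf// expr1n.
have uA : u *m A = a *: u by rewrite -scalemxAl vA !scalerA mulrC.
have [H [HT HH eH]] := orthogonal_completion u1.
have [B defB] : exists B : 'M[R]_(1 + n), B = H *m A *m H by eexists.
have symB : B^T = B by rewrite defB !trmx_mul HT symA mulmxA.
have eB : delta_mx 0 0 *m B = a *: (delta_mx 0 0 : 'rV[R]_n.+1).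
  by rewrite defB !mulmxA eH uA -scalemxAl -eH -mulmxA HH mulmx1.
have B0 (i j : 'I_(1 + n)) : val i = 0%N -> B i j = a * (val j == 0%N)%:R.
  move=> i0; have -> : i = (0 : 'I_n.+1) by exact/val_inj.
  by have /rowP /(_ j) := eB; rewrite -rowE !mxE eqxx/=.
have urB : ursubmx B = 0.
  by apply/matrixP => i j; rewrite ord1 !mxE B0//= mulr0.
have ulB : ulsubmx B = a%:M.
  by apply/matrixP => i j; rewrite !ord1 !mxE B0//= mulr1.
have dlB : dlsubmx B = 0 by rewrite -[B]symB -trmx_ursub urB trmx0.
have [Q' [d' [oQ' dQ']]] : exists Q : 'M[R]_n, exists d : 'rV[R]_n,
    Q *m Q^T = 1%:M /\ Q *m drsubmx B *m Q^T = diag_mx d.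
  by apply: IH; rewrite trmx_drsub symB.
pose Q : 'M[R]_(1 + n) := block_mx 1%:M 0 0 Q'.
have oQ : Q *m Q^T = 1%:M.
  rewrite tr_block_mx !trmx0 trmx1 mulmx_block !mulmx0 !mul0mx !mulmx1 addr0 !add0r.
  by rewrite oQ' -scalar_mx_block.
have eBb : B = block_mx a%:M 0 0 (drsubmx B).
  by rewrite -{1}[B]submxK urB dlB ulB.
have QB : Q *m B *m Q^T = diag_mx (row_mx a%:M d').
  rewrite eBb /Q tr_block_mx !trmx0 trmx1 !mulmx_block.
  rewrite !(mulmx0, mul0mx, mulmx1, mul1mx, addr0, add0r).
  rewrite dQ' diag_mx_row; congr block_mx.
  by apply/matrixP => i j; rewrite !ord1 !mxE eqxx.
exists (Q *m H), (row_mx a%:M d'); split.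
  by rewrite trmx_mul HT mulmxA -[Q *m H *m H]mulmxA HH mulmx1 oQ.
by rewrite trmx_mul HT -QB defB !mulmxA.
Qed.

End Spectral.

(** * Singular values read off a diagonalisation of the Gram matrix *)

Section SingularValueTheory.
Variable R : realType.

Lemma char_poly_orth n (A Q : 'M[R]_n) : Q *m Q^T = 1%:M ->
  char_poly (Q *m A *m Q^T) = char_poly A.
Proof.
move=> oQ; rewrite /char_poly.
have e : map_mx polyC Q *m map_mx polyC Q^T = 1%:M by rewrite -map_mxM oQ map_mx1.
have -> : char_poly_mx (Q *m A *m Q^T) =
    map_mx polyC Q *m char_poly_mx A *m map_mx polyC Q^T.
  rewrite /char_poly_mx mulmxBr mulmxBl !map_mxM.
  by rewrite scalar_mxC -[_ *m map_mx polyC Q *m _]mulmxA e mulmx1.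
by rewrite !det_mulmx mulrAC -det_mulmx e det1 mul1r.
Qed.

Lemma char_poly_diag n (d : 'rV[R]_n) :
  char_poly (diag_mx d) = \prod_(x <- [seq d 0 i | i <- enum 'I_n]) ('X - x%:P).
Proof.
rewrite char_poly_trig ?diag_mx_is_trig// big_map big_enum/=.
by apply: eq_bigr => i _; rewrite mxE eqxx mulr1n.
Qed.

(** An orthogonal diagonalisation splits the characteristic polynomial into linear factors, so root
    multiplicities agree with the number of occurrences on the diagonal. *)
Lemma perm_eigenvalues n (A Q : 'M[R]_n) (d : 'rV[R]_n) :
  Q *m Q^T = 1%:M -> Q *m A *m Q^T = diag_mx d ->
  perm_eq (eigenvalues A) [seq d 0 i | i <- enum 'I_n].
Proof.
move=> oQ dQ; set s := [seq _ | _ <- _].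
have ps : char_poly A = \prod_(x <- s) ('X - x%:P).
  by rewrite -(char_poly_orth A oQ) dQ char_poly_diag.
have p0 : char_poly A != 0 by rewrite monic_neq0 ?char_poly_monic.
have ms x : mup x (char_poly A) = count_mem x s by rewrite ps mu_prod_XsubC.
have inR x : (x \in rootsR (char_poly A)) = (x \in s).
  by rewrite -(roots_on_rootsR p0) inE/= ps root_prod_XsubC.
have uR : uniq (rootsR (char_poly A)) by exact: uniq_roots.
apply/allP => y _ /=; apply/eqP.
rewrite /eigenvalues count_flatten -map_comp sumnE big_map.
have [ys|ys] := boolP (y \in rootsR (char_poly A)).
  rewrite (bigD1_seq y)//= count_nseq/= eqxx mul1n ms big1 ?addn0// => x xy.
  by rewrite /= count_nseq/= (negbTE xy).
rewrite big1_seq => [|x /andP[_ xR]].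
  by apply/esym/count_memPn; rewrite -inR.
rewrite /= count_nseq/=; case: eqP => // xy.
by rewrite -xy xR in ys.
Qed.

(** The characteristic polynomial of the symmetric matrix [M *m M^T] splits over the reals, so no
    eigenvalue is missing from the list and the default of [nth] is met only from position [m]
    on. *)
Lemma size_singular_values m p (M : 'M[R]_(m, p)) : size (singular_values M) = m.
Proof.
have [Q [d [oQ dQ]]] := real_spectral (A := M *m M^T) ltac:(by rewrite trmx_mul trmxK).
by rewrite size_sort size_map (perm_size (perm_eigenvalues oQ dQ)) size_map size_enum_ord.
Qed.

Lemma singular_value_ge0 k m p (M : 'M[R]_(m, p)) : 0 <= singular_value k M.
Proof.
rewrite /singular_value; have [|h] := leqP (size (singular_values M)) k.-1.
  by move=> /(nth_default _) ->.
have := mem_nth 0 h; rewrite /singular_values mem_sort => /mapP[x _ ->].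
exact: sqrtr_ge0.
Qed.

Lemma singular_value_default k m p (M : 'M[R]_(m, p)) :
  (m <= k.-1)%N -> singular_value k M = 0.
Proof. by move=> h; rewrite /singular_value nth_default ?size_singular_values. Qed.

Lemma singular_value_nonincr m p (M : 'M[R]_(m, p)) (i j : nat) : (i <= j < m)%N ->
  nth 0 (singular_values M) j <= nth 0 (singular_values M) i.
Proof.
move=> /andP[ij jm].
have := @sorted_leq_nth R (fun x y => y <= x) _ _ 0 (singular_values M).
apply => //; rewrite ?inE ?size_singular_values ?(leq_ltn_trans ij)//.
- by move=> x y z yx xz; exact: le_trans xz yx.
- by apply: sort_sorted => x y; exact: le_total.
Qed.

(** The rows of [Q] are left singular vectors; the permutation that sorts the singular values is
    absorbed into [Q]. *)
Lemma singular_value_decomposition m p (M : 'M[R]_(m, p)) :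
  exists Q : 'M[R]_m, Q *m Q^T = 1%:M /\
    Q *m (M *m M^T) *m Q^T =
      diag_mx (\row_i (nth 0 (singular_values M) i ^+ 2)).
Proof.
have [Q [d [oQ dQ]]] := real_spectral (A := M *m M^T) ltac:(by rewrite trmx_mul trmxK).
have d0 i : 0 <= d 0 i.
  have -> : d 0 i = sqn (row i (Q *m M)).
    have -> : d 0 i = diag_mx d i i by rewrite [RHS]mxE eqxx mulr1n.
    rewrite -dQ.
    have -> : Q *m (M *m M^T) *m Q^T = (Q *m M) *m (Q *m M)^T.
      by rewrite trmx_mul !mulmxA.
    by rewrite mxE; apply: eq_bigr => j _; rewrite !mxE expr2.
  exact: sqn_ge0.
have pe : perm_eq (singular_values M) [tuple Num.sqrt (d 0 i) | i < m].
  rewrite /singular_values perm_sort.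
  have := perm_map Num.sqrt (perm_eigenvalues oQ dQ).
  by rewrite -map_comp.
have /tuple_permP [s es] := pe.
exists (row_perm s Q); split.
  rewrite row_permE trmx_mul mulmxA -[perm_mx s *m Q *m _]mulmxA oQ mulmx1.
  by rewrite tr_perm_mx -perm_mxM mulgV perm_mx1.
have -> : row_perm s Q *m (M *m M^T) *m (row_perm s Q)^T =
          perm_mx s *m diag_mx d *m (perm_mx s)^T.
  by rewrite row_permE trmx_mul -dQ !mulmxA.
apply/matrixP => i j; rewrite -row_permE tr_perm_mx -col_permE !mxE es.
rewrite -[nth _ _ _](tnth_nth _ _ i) tnth_mktuple tnth_mktuple sqr_sqrtr// (inj_eq perm_inj).
by [].
Qed.

End SingularValueTheory.

(** * Min-max principle and perturbation of singular values *)

Section CourantFischer.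
Variable R : realType.

Lemma sqn_svd m p (M : 'M[R]_(m, p)) (Q : 'M[R]_m) (s : 'I_m -> R) (y : 'rV[R]_m) :
  Q *m (M *m M^T) *m Q^T = diag_mx (\row_i (s i ^+ 2)) ->
  sqn (y *m Q *m M) = \sum_i y 0 i ^+ 2 * s i ^+ 2.
Proof.
move=> h; rewrite sqnE !trmx_mul.
have -> : y *m Q *m M *m (M^T *m (Q^T *m y^T)) =
          y *m (Q *m (M *m M^T) *m Q^T) *m y^T by rewrite !mulmxA.
rewrite h mxE; apply: eq_bigr => i _; rewrite mul_mx_diag !mxE; ring.
Qed.

Lemma capmx_neq0 m1 m2 n (A : 'M[R]_(m1, n)) (B : 'M[R]_(m2, n)) :
  (n < \rank A + \rank B)%N ->
  exists2 x : 'rV[R]_n, x != 0 & (x <= A)%MS /\ (x <= B)%MS.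
Proof.
rewrite -mxrank_sum_cap => h.
have : (0 < \rank (A :&: B)%MS)%N.
  rewrite lt0n; apply: contraTN h => /eqP ->.
  by rewrite addn0 -leqNgt rank_leq_col.
rewrite lt0n mxrank_eq0 => /rowV0Pn[x xAB x0].
by exists x => //; move: xAB; rewrite sub_capmx => /andP.
Qed.

(** The row space of [pid_mx k *m Q] is the span of the [k] leading left singular vectors. *)
Lemma nrm_svd_top m p (M : 'M[R]_(m, p)) (Q : 'M[R]_m) k (x : 'rV[R]_m) :
  Q *m Q^T = 1%:M ->
  Q *m (M *m M^T) *m Q^T = diag_mx (\row_i (nth 0 (singular_values M) i ^+ 2)) ->
  (0 < k <= m)%N -> (x <= (pid_mx k : 'M[R]_m) *m Q)%MS ->
  singular_value k M * nrm x <= nrm (x *m M).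
Proof.
move=> oQ dQ /andP[k0 km] /submxP[y xE].
pose z : 'rV[R]_m := y *m pid_mx k.
have zE (i : 'I_m) : (k <= i)%N -> z 0 i = 0.
  move=> ki; rewrite mxE big1// => j _; rewrite mxE.
  by case: eqP => [->|]; rewrite ?mulr0// ltnNge ki mulr0.
have xz : x = z *m Q by rewrite xE mulmxA.
rewrite -(ler_pXn2r (n := 2)) ?nnegrE ?mulr_ge0 ?nrm_ge0 ?singular_value_ge0//.
rewrite exprMn !nrm_sqr xz (sqn_svd _ dQ) sqn_mulmx_orth//.
rewrite mulrC mulr_suml; apply: ler_sum => i _.
have [ki|ik] := leqP k i; first by rewrite zE// expr0n !mul0r.
apply: ler_wpM2l; first exact: sqr_ge0.
rewrite ler_pXn2r ?nnegrE ?singular_value_ge0//; last exact: (singular_value_ge0 i.+1).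
by apply: singular_value_nonincr; lia.
Qed.

(** Only [k.-1] leading vectors are discarded, so the [k]-th one belongs to this span too; for
    [0 < k <= m] its dimension is [m - k + 1], enough to meet every subspace of dimension [k]. *)
Lemma nrm_svd_bottom m p (M : 'M[R]_(m, p)) (Q : 'M[R]_m) k (x : 'rV[R]_m) :
  Q *m Q^T = 1%:M ->
  Q *m (M *m M^T) *m Q^T = diag_mx (\row_i (nth 0 (singular_values M) i ^+ 2)) ->
  (x <= (copid_mx k.-1 : 'M[R]_m) *m Q)%MS ->
  nrm (x *m M) <= singular_value k M * nrm x.
Proof.
move=> oQ dQ /submxP[y xE].
pose z : 'rV[R]_m := y *m copid_mx k.-1.
have zE (i : 'I_m) : (i < k.-1)%N -> z 0 i = 0.
  move=> ki; rewrite mxE big1// => j _; rewrite !mxE.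
  have -> : (j == i)%:R = ((j == i :> nat) && (j < k.-1)%N)%:R :> R.
    rewrite (_ : (j == i) = (j == i :> nat)) //.
    by case: (@eqP nat j i) => // ->; rewrite ki.
  by rewrite subrr mulr0.
have xz : x = z *m Q by rewrite xE mulmxA.
rewrite nrm_le ?singular_value_ge0// xz (sqn_svd _ dQ) sqn_mulmx_orth//.
rewrite [leRHS]mulrC mulr_suml; apply: ler_sum => i _.
have [ki|ik] := ltnP i k.-1; first by rewrite zE// expr0n !mul0r.
apply: ler_wpM2l; first exact: sqr_ge0.
rewrite ler_pXn2r ?nnegrE ?singular_value_ge0//; last exact: (singular_value_ge0 i.+1).
by apply: singular_value_nonincr; rewrite ik/=.
Qed.

(** One half of Courant-Fischer: by dimension count [B] contains a nonzero combination of the [k]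
    leading left singular vectors, which [M] stretches by at least the [k]-th singular value. *)
Lemma singular_value_le m p (M : 'M[R]_(m, p)) q (B : 'M[R]_(q, m)) k c :
  0 <= c -> (0 < k)%N -> (m < \rank B + k)%N ->
  (forall x : 'rV[R]_m, (x <= B)%MS -> nrm (x *m M) <= c * nrm x) ->
  singular_value k M <= c.
Proof.
move=> c0 k0 rB hB.
have [km|mk] := leqP k m; last by rewrite singular_value_default// -ltnS prednK.
have [Q [oQ dQ]] := singular_value_decomposition M.
have Qu : Q \in unitmx by case/mulmx1_unit: oQ.
have rT : (m < \rank B + \rank ((pid_mx k : 'M[R]_m) *m Q))%N.
  by rewrite mxrankMfree ?row_free_unit// rank_pid_mx.
have [x x0 [xB xT]] := capmx_neq0 rT.
have nx : 0 < nrm x by rewrite nrm_gt0.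
rewrite -(ler_pM2r nx); apply: le_trans (hB _ xB).
by apply: (nrm_svd_top oQ dQ) xT; rewrite k0.
Qed.

Lemma singular_value_ge m p (M : 'M[R]_(m, p)) q (B : 'M[R]_(q, m)) k c :
  (0 < k)%N -> (k <= \rank B)%N ->
  (forall x : 'rV[R]_m, (x <= B)%MS -> c * nrm x <= nrm (x *m M)) ->
  c <= singular_value k M.
Proof.
move=> k0 rB hB.
have km : (k <= m)%N by exact: leq_trans rB (rank_leq_col _).
have [Q [oQ dQ]] := singular_value_decomposition M.
have Qu : Q \in unitmx by case/mulmx1_unit: oQ.
have rT : (m < \rank B + \rank ((copid_mx k.-1 : 'M[R]_m) *m Q))%N.
  rewrite mxrankMfree ?row_free_unit// rank_copid_mx; last by rewrite (leq_trans (leq_pred _)).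
  lia.
have [x x0 [xB xT]] := capmx_neq0 rT.
have nx : 0 < nrm x by rewrite nrm_gt0.
rewrite -(ler_pM2r nx); apply: (le_trans (hB _ xB)).
exact: (nrm_svd_bottom oQ dQ).
Qed.

(** On the kernel of [A], of dimension greater than [m - k], the matrix [A + E] acts as [E]. *)
Lemma singular_value_low_rank m p (A E : 'M[R]_(m, p)) k s :
  (\rank A < k)%N -> 0 <= s ->
  (forall y : 'rV[R]_m, nrm (y *m E) <= s * nrm y) ->
  singular_value k (A + E) <= s.
Proof.
move=> rA s0 hE.
apply: (@singular_value_le _ _ _ _ (kermx A)) => //; first exact: leq_ltn_trans rA.
  by rewrite mxrank_ker; have := rank_leq_row A; lia.
by move=> x /sub_kermxP xA; rewrite mulmxDr xA add0r.
Qed.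

(** Used for measurability, for which the entrywise distance is precise enough. *)
Lemma singular_value_lipschitz m p (A B : 'M[R]_(m, p)) k : (0 < k)%N ->
  singular_value k A <= singular_value k B + \sum_i \sum_j `|(A - B) i j|.
Proof.
move=> k0; have L0 : 0 <= \sum_i \sum_j `|(A - B) i j|.
  by do 2 apply: sumr_ge0 => ? _.
have [km|mk] := leqP k m; last first.
  by rewrite singular_value_default ?addr_ge0 ?singular_value_ge0// -ltnS prednK.
have [Q [oQ dQ]] := singular_value_decomposition B.
have Qu : Q \in unitmx by case/mulmx1_unit: oQ.
apply: (@singular_value_le _ _ _ _ ((copid_mx k.-1 : 'M[R]_m) *m Q)) => //.
- by rewrite addr_ge0 ?singular_value_ge0.
- rewrite mxrankMfree ?row_free_unit// rank_copid_mx; last by rewrite (leq_trans (leq_pred _)).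
  lia.
move=> x xT.
have -> : x *m A = x *m B + x *m (A - B) by rewrite -mulmxDr addrC subrK.
apply: le_trans (nrmD _ _) _; rewrite mulrDl; apply: lerD; last exact: nrm_mulmx_le.
exact: (nrm_svd_bottom oQ dQ).
Qed.

(* Only the [k]-dimensional compression of the noise to the leading singular
   subspaces of [A] matters. *)
Lemma singular_value_compression m p (A : 'M[R]_(m, p)) k c :
  (0 < k)%N -> 0 < c -> c <= singular_value k A ->
  exists X : 'M[R]_(k, m), exists V : 'M[R]_(k, p),
    [/\ X *m X^T = 1%:M, V *m V^T = 1%:M &
    forall E s, 0 <= s ->
      (forall y : 'rV[R]_k, nrm (y *m (X *m E *m V^T)) <= s * nrm y) ->
      c - s <= singular_value k (A + E)].
Proof.
move=> k0 c0 hc.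
have km : (k <= m)%N.
  rewrite leqNgt; apply/negP => mk; move: hc.
  by rewrite singular_value_default; [rewrite leNgt c0|lia].
have [Q [oQ dQ]] := singular_value_decomposition A.
pose sv i := nth 0 (singular_values A) i.
have svc i : (i < k)%N -> c <= sv i.
  move=> ik; apply: le_trans hc _; apply: singular_value_nonincr.
  lia.
have sv0 i : (i < k)%N -> 0 < sv i by move=> ik; exact: lt_le_trans (svc _ ik).
pose X : 'M[R]_(k, m) := pid_mx k *m Q.
have pp : (pid_mx k : 'M[R]_(k, m)) *m (pid_mx k : 'M[R]_(k, m))^T = 1%:M.
  by rewrite tr_pid_mx pid_mx_id// pid_mx_1.
have oX : X *m X^T = 1%:M.
  by rewrite trmx_mul mulmxA -[X *m Q^T]mulmxA oQ mulmx1.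
pose S : 'M[R]_k := diag_mx (\row_i sv i).
pose S' : 'M[R]_k := diag_mx (\row_i (sv i)^-1).
have SS' : S *m S' = 1%:M.
  rewrite /S /S' mulmx_diag; apply/matrixP => i j; rewrite !mxE.
  by case: eqP => // ->; rewrite divff// gt_eqF// sv0.
have XA : (X *m A) *m (X *m A)^T = S *m S.
  have -> : (X *m A) *m (X *m A)^T = pid_mx k *m (Q *m (A *m A^T) *m Q^T) *m (pid_mx k)^T.
    by rewrite /X !trmx_mul !mulmxA.
  rewrite dQ tr_pid_mx; apply/matrixP => i j; rewrite mulmx_diag.
  rewrite mul_mx_diag mxE (bigD1 (widen_ord km i))//= big1 ?addr0 => [|l li].
    rewrite !mxE/= eqxx ltn_ord mul1r; case: eqVneq => ij.
      by rewrite (_ : i == j) ?mulr1 ?mulr1n; last exact/eqP/val_inj.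
    by rewrite (_ : i == j = false) ?mulr0 ?mulr0n//; apply/eqP => E; rewrite E eqxx in ij.
  rewrite !mxE (_ : (i == l :> nat) = false) ?mul0r//.
  by apply: contraNF li => /eqP h; apply/eqP/val_inj.
have S'T : S'^T = S' by rewrite tr_diag_mx.
(* The rows of the second witness are the leading right singular vectors: the images of the left
   ones, divided by singular values that are positive because they are at least [c]. *)
exists X, (S' *m (X *m A)).
have S'S : S' *m S = 1%:M by apply: mulmx1C.
set V := S' *m (X *m A).
have oV : V *m V^T = 1%:M.
  have -> : V *m V^T = S' *m ((X *m A) *m (X *m A)^T) *m S'.
    by rewrite /V trmx_mul S'T !mulmxA.
  by rewrite XA !mulmxA S'S mul1mx SS'.
have XAV : X *m A = S *m V by rewrite /V mulmxA SS' mul1mx.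
split; [exact: oX|exact: oV|move=> E s s0 hE].
apply: (@singular_value_ge _ _ _ _ X) => //.
  rewrite -[leqLHS](@mxrank1 R k) -oX; exact: mxrankM_maxl.
move=> x /submxP[y ->]; rewrite (nrm_mulmx_orth y oX).
(* Projecting to the row space of [V] can only shorten the image, turns [A] into the diagonal [S],
   and reduces the noise to [X *m E *m V^T]. *)
apply: le_trans (nrm_mulmx_tr_orth _ oV).
have -> : y *m X *m (A + E) *m V^T = y *m S + y *m (X *m E *m V^T).
  have h : X *m A *m V^T = S by rewrite XAV -(mulmxA S) oV mulmx1.
  by rewrite -h mulmxDr mulmxDl !mulmxA.
apply: le_trans (lerB_nrm _ _); rewrite mulrBl; apply: lerB => //.
rewrite -(ler_pXn2r (n := 2)) ?nnegrE ?mulr_ge0 ?nrm_ge0 ?(ltW c0)//.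
rewrite exprMn !nrm_sqr mulrC mulr_suml; apply: ler_sum => i _.
rewrite mul_mx_diag !mxE exprMn ler_wpM2l ?sqr_ge0//.
by rewrite ler_pXn2r ?nnegrE ?(ltW c0) ?(ltW (sv0 _ _)) ?svc.
Qed.

End CourantFischer.

(** * Grid nets of the unit ball *)

Section GridNet.
Variable R : realType.

(** The multiples of [1 / M] in the cube [[-1, 1]^k], indexed by a finite type so that they can be
    counted. *)
Definition grid (k M : nat) (f : {ffun 'I_k -> 'I_(M.*2.+1)}) : 'rV[R]_k :=
  \row_i (((f i)%:R - M%:R) / M%:R).

(** Coordinates are rounded towards 0: the error is at most [1 / M] in each of them, and the norm
    does not grow, so the net stays inside the unit ball. *)
Lemma grid_approx (k M : nat) (y : 'rV[R]_k) : (0 < M)%N -> nrm y <= 1 ->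
  exists f : {ffun 'I_k -> 'I_(M.*2.+1)},
    nrm (grid f) <= 1 /\ nrm (y - grid f) <= Num.sqrt k%:R / M%:R.
Proof.
move=> M0 y1.
have MR : 0 < M%:R :> R by rewrite ltr0n.
have yi i : `|y 0 i| <= 1.
  rewrite -(ler_pXn2r (n := 2)) ?nnegrE// expr1n real_normK ?num_real//.
  apply: (@le_trans _ _ (sqn y)).
    by rewrite /sqn (bigD1 i)//= lerDl; apply: sumr_ge0 => j _; exact: sqr_ge0.
  by rewrite -nrm_sqr expr_le1// nrm_ge0.
pose a i := Num.truncn (M%:R * `|y 0 i|).
have aM i : (a i <= M)%N.
  have [/andP[h _]] := truncn_itv (mulr_ge0 (ltW MR) (normr_ge0 (y 0 i))).
  rewrite -(ler_nat R); apply: (le_trans h).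
  by rewrite ler_piMr// ltW.
pose e i : R := if 0 <= y 0 i then 1 else -1.
have e2 i : e i ^+ 2 = 1 by rewrite /e; case: ifP; rewrite ?sqrrN expr1n.
have yE i : y 0 i = e i * `|y 0 i|.
  rewrite /e; case: ifPn => [/ger0_norm ->|]; first by rewrite mul1r.
  by rewrite -ltNge => /ltr0_norm ->; rewrite mulN1r opprK.
have jP i : ((if (0 <= y 0 i)%R then M + a i else M - a i) < M.*2.+1)%N.
  by have := aM i; case: ifP => _; lia.
exists [ffun i => Ordinal (jP i)].
have aE i : 0 <= `|y 0 i| - (a i)%:R / M%:R <= M%:R^-1.
  have /andP[h1 h2] := truncn_itv (mulr_ge0 (ltW MR) (normr_ge0 (y 0 i))).
  rewrite subr_ge0 ler_pdivrMr// mulrC h1/= lerBlDl -[X in _ + X]mul1r -mulrDl natr1.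
  by rewrite ler_pdivlMr// mulrC ltW.
have gE i : grid [ffun i => Ordinal (jP i)] 0 i = e i * ((a i)%:R / M%:R).
  have M0' : M%:R != 0 :> R by rewrite gt_eqF.
  rewrite mxE ffunE/= /e; case: ifP => _; first by rewrite natrD; field.
  by rewrite natrB//; field.
split.
  apply: le_trans y1; rewrite -[leRHS]mul1r nrm_le// expr1n mul1r.
  apply: ler_sum => i _; rewrite gE exprMn e2 mul1r -[leRHS]real_normK ?num_real//.
  rewrite ler_pXn2r ?nnegrE ?divr_ge0//.
  by have /andP[+ _] := aE i; rewrite subr_ge0.
have -> : Num.sqrt k%:R / M%:R = Num.sqrt (\sum_(i < k) M%:R^-1 ^+ 2) :> R.
  by rewrite sumr_const card_ord -[_ ^+ 2 *+ k]mulr_natl sqrtrM//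
    sqrtr_sqr ger0_norm ?invr_ge0.
rewrite ler_sqrt; last by apply: sumr_ge0 => i _; exact: sqr_ge0.
apply: ler_sum => i _; rewrite mxE [X in _ + X]mxE gE [y 0 i]yE -mulrBr exprMn e2 mul1r.
by have /andP[h1 h2] := aE i; rewrite ler_pXn2r ?nnegrE ?invr_ge0.
Qed.

(** The operator norm, the finite supremum [sup B], is at most its value on the net plus [eps] times
    itself; solving for it gives the factor [1 - eps]. *)
Lemma nrm_mulmx_grid (k l M : nat) (G : 'M[R]_(k, l)) (s : R) :
  (0 < M)%N -> Num.sqrt k%:R / M%:R < 1 :> R ->
  (forall f : {ffun 'I_k -> 'I_(M.*2.+1)}, nrm (grid f) <= 1 ->
     nrm (grid f *m G) <= (1 - Num.sqrt k%:R / M%:R) * s) ->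
  forall y, nrm (y *m G) <= s * nrm y.
Proof.
set eps := _ / _ => M0 eps1 hG.
pose B : set R := [set nrm (y *m G) | y in [set y : 'rV[R]_k | nrm y <= 1]].
have supB : has_sup B.
  split; first by exists (nrm (0 *m G)), 0 => //=; rewrite nrm0.
  exists (\sum_i \sum_j `|G i j|) => _ [y /= y1 <-].
  apply: le_trans (nrm_mulmx_le _ _) _; rewrite -[leRHS]mulr1 ler_wpM2l//.
  by do 2 apply: sumr_ge0 => ? _.
have leB y : nrm (y *m G) <= sup B * nrm y.
  have [->|y0] := eqVneq y 0; first by rewrite mul0mx !nrm0 mulr0.
  have ny : 0 < nrm y by rewrite nrm_gt0.
  rewrite -ler_pdivrMr// mulrC -[_^-1]ger0_norm ?invr_ge0 ?nrm_ge0// -nrmZ scalemxAl.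
  apply: ub_le_sup; first exact: supB.2.
  by exists ((nrm y)^-1 *: y) => //=;
    rewrite nrmZ ger0_norm ?invr_ge0 ?nrm_ge0// mulVf// gt_eqF.
have supB0 : 0 <= sup B.
  apply: ub_le_sup; first exact: supB.2.
  by exists 0 => /=; rewrite ?mul0mx nrm0.
have : sup B <= (1 - eps) * s + eps * sup B.
  apply: ge_sup; first exact: supB.1.
  move=> _ [y /= y1 <-]; have [f [f1 fy]] := grid_approx M0 y1.
  have -> : y *m G = grid f *m G + (y - grid f) *m G by rewrite -mulmxDl addrC subrK.
  apply: le_trans (nrmD _ _) _; apply: lerD; first exact: hG.
  by apply: le_trans (leB _) _; rewrite mulrC ler_wpM2r.
rewrite -lerBlDr -{1}[sup B]mul1r -mulrBl ler_pM2l ?subr_gt0// => h y.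
by apply: le_trans (leB y) _; rewrite ler_wpM2r ?nrm_ge0.
Qed.

End GridNet.

(** * Operator norm of a compressed Gaussian matrix *)

Section GaussianOperatorNorm.
Variable R : realType.

(** The complement controls the operator norm, while the event itself is a finite union of
    conditions on one vector each: it is measurable and open to a union bound. *)
Definition net_bad (T : Type) (k l M : nat) (G : T -> 'M[R]_(k, l)) (s : R) : set T :=
  \big[setU/set0]_(f : {ffun 'I_k -> 'I_(M.*2.+1)} | nrm (grid R f) <= 1)
    [set w | s ^+ 2 < sqn (grid R f *m G w)].

Lemma measurable_lt_set d (T : measurableType d) (f g : T -> R) :
  measurable_fun setT f -> measurable_fun setT g -> measurable [set w | f w < g w].
Proof.
move=> mf mg.
have -> : [set w | f w < g w] = [set: T] `&` (fun w => g w - f w) @^-1` `]0, +oo[%classic.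
  by apply/seteqP; split => w /=; rewrite in_itv/= andbT subr_gt0; tauto.
have : measurable_fun setT (fun w => g w - f w) by exact: measurable_funB.
exact.
Qed.

Lemma measurable_net_cell d (T : measurableType d) k l (G : T -> 'M[R]_(k, l)) (s : R)
    (z : 'rV[R]_k) :
  (forall i j, measurable_fun setT (fun w => G w i j)) ->
  measurable [set w | s ^+ 2 < sqn (z *m G w)].
Proof.
move=> mG; apply: measurable_lt_set => //; rewrite /sqn.
apply: measurable_sum => j; apply: measurable_funX.
rewrite (_ : (fun w => _) = (fun w => \sum_i z 0 i * G w i j)); last first.
  by apply/funext => w; rewrite mxE.
by apply: measurable_sum => i; exact: measurable_funM.
Qed.

Lemma measurable_net_bad d (T : measurableType d) k l M (G : T -> 'M[R]_(k, l)) (s : R) :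
  (forall i j, measurable_fun setT (fun w => G w i j)) ->
  measurable (net_bad M G s).
Proof.
move=> mG; rewrite /net_bad; apply: bigsetU_measurable => f _.
exact: measurable_net_cell.
Qed.

Lemma net_badP (T : Type) k l M (G : T -> 'M[R]_(k, l)) (s S : R) w :
  (0 < M)%N -> Num.sqrt k%:R / M%:R < 1 :> R -> 0 <= S ->
  s = (1 - Num.sqrt k%:R / M%:R) * S -> ~ net_bad M G s w ->
  forall y, nrm (y *m G w) <= S * nrm y.
Proof.
move=> M0 eps1 S0 es nbad; apply: (nrm_mulmx_grid M0 eps1) => f f1.
have s0 : 0 <= s by rewrite es mulr_ge0// subr_ge0 ltW.
rewrite -es leNgt; apply/negP => h; apply: nbad.
rewrite /net_bad (bigD1 f)//=; left => /=.
by rewrite -nrm_sqr ltr_pXn2r// nnegrE ?nrm_ge0.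
Qed.

Lemma union_bound d (T : measurableType d) (P : probability T R) (I : Type)
    (s : seq I) (p : pred I) (A : I -> set T) (c : R) : 0 <= c ->
  (forall i, p i -> measurable (A i)) -> (forall i, p i -> (P (A i) <= c%:E)%E) ->
  (P (\big[setU/set0]_(i <- s | p i) A i) <= ((size s)%:R * c)%:E)%E.
Proof.
move=> c0 mA hA; elim: s => [|i s IH]; first by rewrite big_nil measure0 mul0r.
rewrite big_cons/=; case: ifPn => pi.
  apply: le_trans (measureU2 _ _ _) _ => //; first exact: mA.
    by apply: bigsetU_measurable => j; exact: mA.
  by rewrite -natr1 mulrDl mul1r addrC EFinD leeD// hA.
apply: le_trans IH _; rewrite lee_fin ler_wpM2r// ler_nat; exact: leqnSn.
Qed.

(** For a grid point [z], the linear form [h] of [z *m G] has as coefficients the products of the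
    entries of [z *m X0] and of [h *m V0]. Their total squared norm is at most that of [h], as both
    factors have orthonormal rows and [z] lies in the unit ball. Hence only the compressed
    dimensions [k] and [l] enter the bound. *)
Lemma gaussian_net d (T : measurableType d) (P : probability T R) (I : eqType)
    (sigma : R) (X : I -> {RV P >-> R}) k l m q M
    (phi : 'I_m * 'I_q -> I) (X0 : 'M[R]_(k, m)) (V0 : 'M[R]_(l, q)) (s : R) :
  0 < sigma -> iid_normal sigma X -> injective phi ->
  X0 *m X0^T = 1%:M -> V0 *m V0^T = 1%:M -> (0 < l)%N -> Num.sqrt l%:R <= s ->
  (P (net_bad M (fun w => X0 *m (\matrix_(a, b) X (phi (a, b)) w) *m V0^T) (sigma * s)) <=
   ((M.*2.+1 ^ k)%:R * expR (- ((s - Num.sqrt l%:R) ^+ 2 / 2)))%:E)%E.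
Proof.
move=> sigma0 iidX iphi oX oV l0 ls.
pose G w := X0 *m (\matrix_(a, b) X (phi (a, b)) w) *m V0^T.
have mG i j : measurable_fun setT (fun w => G w i j).
  rewrite (_ : (fun w => _) =
    (fun w => \sum_b (\sum_a X0 i a * X (phi (a, b)) w) * V0 j b)); last first.
    apply/funext => w; rewrite /G mxE; apply: eq_bigr => b _; rewrite !mxE.
    by congr (_ * _); apply: eq_bigr => a _; rewrite mxE.
  apply: measurable_sum => b; apply: measurable_funM => //.
  by apply: measurable_sum => a; exact: measurable_funM.
have -> : (M.*2.+1 ^ k)%N = size (index_enum {ffun 'I_k -> 'I_(M.*2.+1)}).
  by rewrite -[size _]count_predT -sum1_count sum1_card card_ffun !card_ord.
apply: union_bound => [|f f1|f f1]; first exact: expR_ge0.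
  exact: measurable_net_cell.
pose z := grid R f.
pose v (j : 'I_l) w := (z *m G w) 0 j.
have mv j : measurable_fun setT (v j).
  rewrite (_ : v j = (fun w => \sum_i z 0 i * G w i j)); last first.
    by apply/funext => w; rewrite /v mxE.
  by apply: measurable_sum => i; exact: measurable_funM.
have := @chi_tail R _ T P 'I_l v mv sigma s sigma0.
rewrite card_ord; apply => // h.
pose x := z *m X0; pose g := (\row_j h j) *m V0.
have E w : \sum_j h j * v j w = \sum_(p : 'I_m * 'I_q) (x 0 p.1 * g 0 p.2) * X (phi p) w.
  rewrite [RHS](eq_bigr (fun p => x 0 p.1 * g 0 p.2 * X (phi (p.1, p.2)) w)) => [|[]//].
  rewrite -(pair_bigA _ (fun a b => (x 0 a * g 0 b) * X (phi (a, b)) w))/=.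
  transitivity ((x *m (\matrix_(a, b) X (phi (a, b)) w) *m g^T) 0 0).
    have -> : x *m (\matrix_(a, b) X (phi (a, b)) w) *m g^T = (z *m G w) *m (\row_j h j)^T.
      by rewrite /x /g /G trmx_mul !mulmxA.
    rewrite [RHS]mxE; apply: eq_bigr => j _.
    by rewrite [(_^T) _ _]mxE [(\row__ _) _ _]mxE mulrC.
  rewrite mxE exchange_big/=; apply: eq_bigr => b _.
  rewrite [(g^T) _ _]mxE [(x *m _) _ _]mxE mulr_suml.
  by apply: eq_bigr => a _; rewrite [(\matrix_(_, _) _) _ _]mxE mulrAC.
under eq_integral do rewrite E.
rewrite (normal_mgf sigma0 iidX) // lee_fin ler_expR ler_pM2r// ler_pM2l ?exprn_gt0//.
have -> : \sum_(p : 'I_m * 'I_q) (x 0 p.1 * g 0 p.2) ^+ 2 = sqn x * sqn g.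
  rewrite -(pair_bigA _ (fun a b => (x 0 a * g 0 b) ^+ 2))/= /sqn mulr_suml.
  apply: eq_bigr => a _; rewrite mulr_sumr; apply: eq_bigr => b _; exact: exprMn.
have -> : sqn g = \sum_j h j ^+ 2.
  by rewrite sqn_mulmx_orth//; apply: eq_bigr => j _; rewrite mxE.
rewrite ler_piMl ?sumr_ge0// => [j _|]; first exact: sqr_ge0.
by rewrite sqn_mulmx_orth// -nrm_sqr expr_le1// nrm_ge0.
Qed.

End GaussianOperatorNorm.

(** * Cutting a tensor train at a bond *)

Section TensorTrainRank.
Variables (R : realType) (d : nat) (r n : 'I_d -> nat) (tau : 'S_d).
Variables (u : tt_cores R r n tau).

Lemma iter_ordS_val (hd : (0 < d)%N) (k : nat) :
  val (iter k (@ordS d) (Ordinal hd)) = (k %% d)%N.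
Proof.
elim: k => [|k IH] /=; first by rewrite mod0n.
by rewrite [val (iter _ _ _)]IH -addn1 modnDml addn1.
Qed.

(** The remaining factor [G] is a function of the whole multi-index; the second clause records that
    it reads only the coordinates at positions from [k'] to [k - 1] after [j]. *)
Lemma tt_chain_split (j : 'I_d) (k' k : nat) : (k' <= k)%N ->
  exists G : mindex n -> 'M[R]_(r (iter k' (@ordS d) j), r (iter k (@ordS d) j)),
    (forall x, tt_chain u x j k = tt_chain u x j k' *m G x) /\
    (forall x x' : mindex n, (forall l, (k' <= l < k)%N ->
       x (tau (iter l (@ordS d) j)) = x' (tau (iter l (@ordS d) j))) -> G x = G x').
Proof.
elim: k => [|k IH].
  by rewrite leqn0 => /eqP ->; exists (fun=> 1%:M); split => // x; rewrite mulmx1.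
rewrite leq_eqVlt => /orP[/eqP ->|].
  by exists (fun=> 1%:M); split => // x; rewrite mulmx1.
rewrite ltnS => k'k; have [G [G1 G2]] := IH k'k.
exists (fun x => G x *m core_at u x (iter k (@ordS d) j)); split => [x|x x' xx'].
  by rewrite /= G1 mulmxA.
rewrite (G2 x x') => [|l /andP[h1 h2]]; last by apply: xx'; rewrite h1 ltnW.
by rewrite /core_at xx'// k'k ltnSn.
Qed.

Lemma conform_mulmx_sum p q s (A : 'M[R]_(p, q)) (B : 'M[R]_(q, s)) :
  p = 1%N -> s = 1%N ->
  conform_mx (0 : 'M[R]_1) (A *m B) 0 0 =
  \sum_b conform_mx (0 : 'M[R]_(1, q)) A 0 b * conform_mx (0 : 'M[R]_(q, 1)) B b 0.
Proof. by move=> p1 s1; subst p s; rewrite !conform_mx_id mxE. Qed.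

(** The inner size is a separate [q] with [q = r k], since the chain produces it in the form
    [r (iter k _ _)], which is equal to [r k] only by a proof. *)
Lemma tt_entry_split (hd : (0 < d)%N) (k : 'I_d) :
  (forall j : 'I_d, val j = 0%N -> r j = 1%N) ->
  exists q, exists L G : mindex n -> 'I_q -> R,
  [/\ q = r k, forall x, tt_entry hd u x = \sum_b L x b * G x b,
      forall x x' : mindex n, (forall j : 'I_d, (j < k)%N -> x (tau j) = x' (tau j)) ->
        L x =1 L x' &
      forall x x' : mindex n, (forall j : 'I_d, (k <= j)%N -> x (tau j) = x' (tau j)) ->
        G x =1 G x'].
Proof.
move=> r1.
have itE l (ld : (l < d)%N) : iter l (@ordS d) (Ordinal hd) = Ordinal ld.
  by apply: val_inj; rewrite iter_ordS_val modn_small.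
have itk : iter k (@ordS d) (Ordinal hd) = k by rewrite itE; exact: val_inj.
have [L [_ L2]] := @tt_chain_split (Ordinal hd) 0 k (leq0n _).
have [G [G1 G2]] := @tt_chain_split (Ordinal hd) k d (ltnW (ltn_ord k)).
exists (r (iter k (@ordS d) (Ordinal hd))).
exists (fun x b => conform_mx (0 : 'M[R]_(1, _)) (tt_chain u x (Ordinal hd) k) 0 b).
exists (fun x b => conform_mx (0 : 'M[R]_(_, 1)) (G x) b 0).
split.
- by rewrite itk.
- move=> x; rewrite /tt_entry G1 conform_mulmx_sum//; first exact: r1.
  (* After [d] cyclic steps the chain is back at position 0, so its right size is [r_1 = 1] as
     well. *)
  by apply: r1; rewrite iter_ordS_val modnn.
- move=> x x' h b; suff -> : tt_chain u x (Ordinal hd) k = tt_chain u x' (Ordinal hd) k by [].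
  have aux m : (m <= k)%N -> tt_chain u x (Ordinal hd) m = tt_chain u x' (Ordinal hd) m.
    elim: m => //= m IH mk; rewrite IH ?(ltnW mk)//; congr (_ *m _).
    rewrite /core_at h//; by rewrite (itE _ (ltn_trans mk (ltn_ord k))).
  exact: aux.
- move=> x x' h b; rewrite (G2 x x')// => l /andP[kl ld].
  by rewrite (itE _ ld) h.
Qed.

End TensorTrainRank.

(** * Symmetries, noise entries and rank of matricizations *)

Section Matricizations.
Variable R : realType.

Lemma unfoldE p q s (F : 'I_p -> 'I_q -> 'I_s -> R) a b c :
  unfold F a (mxvec_index b c) = F a b c.
Proof. by rewrite !mxE mxvecE mxE. Qed.

Lemma unfold_gram p q s (F : 'I_p -> 'I_q -> 'I_s -> R) :
  unfold F *m (unfold F)^T =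
  \matrix_(a, a') \sum_b \sum_c F a b c * F a' b c.
Proof.
apply/matrixP => a a'; rewrite !mxE (reindex _ (curry_mxvec_bij _ _))/=.
rewrite pair_bigA/=; apply: eq_bigr => -[b c] _ /=.
by rewrite [_^T _ _]mxE !unfoldE.
Qed.

(** Singular values are defined through [M *m M^T], which ignores the order of columns. This reduces
    the three matrices of a call to instances of [M2_13]. *)
Lemma eq_singular_value k m p q (M : 'M[R]_(m, p)) (N : 'M[R]_(m, q)) :
  M *m M^T = N *m N^T -> singular_value k M = singular_value k N.
Proof. by move=> e; rewrite /singular_value /singular_values e. Qed.

Lemma singular_value_unfoldC k p q s (F : 'I_p -> 'I_q -> 'I_s -> R) :
  singular_value k (unfold F) = singular_value k (unfold (fun a c b => F a b c)).
Proof.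
apply: eq_singular_value; rewrite !unfold_gram.
by apply/matrixP => a a'; rewrite !mxE exchange_big.
Qed.

Variables (d : nat) (n : 'I_d -> nat).
Implicit Types (T Z : mindex n -> R) (y : mindex n).

Lemma subtensor_swapl T y i1 i2 i3 a b c : i1 != i2 ->
  @subtensor R d n T y i1 i2 i3 a b c = subtensor T y b a c.
Proof.
move=> i12; have i21 : i2 != i1 by rewrite eq_sym.
rewrite /subtensor; congr T; apply/ffunP => k; rewrite !ffunE.
have [k3|k3] := eqVneq i3 k; first by subst k; rewrite !dfwithin.
rewrite 2?(@dfwithout _ _ _ i3)//.
have [k2|k2] := eqVneq i2 k.
  by subst k; rewrite dfwithin (@dfwithout _ _ _ i1)// dfwithin.
rewrite (@dfwithout _ _ _ i2)//; have [k1|k1] := eqVneq i1 k.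
  by subst k; rewrite !dfwithin.
by rewrite 2?(@dfwithout _ _ _ i1)// (@dfwithout _ _ _ i2).
Qed.

Lemma subtensor_swapr T y i1 i2 i3 a b c : i2 != i3 ->
  @subtensor R d n T y i1 i2 i3 a b c = subtensor T y a c b.
Proof.
move=> i23; have i32 : i3 != i2 by rewrite eq_sym.
rewrite /subtensor; congr T; apply/ffunP => k; rewrite !ffunE.
have [k3|k3] := eqVneq i3 k.
  by subst k; rewrite dfwithin (@dfwithout _ _ _ i2)// dfwithin.
rewrite (@dfwithout _ _ _ i3)//; have [k2|k2] := eqVneq i2 k.
  by subst k; rewrite !dfwithin.
by rewrite 2?(@dfwithout _ _ _ i2)// (@dfwithout _ _ _ i3).
Qed.

Lemma singular_value_M1_23 k T y i1 i2 i3 : i1 != i2 ->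
  singular_value k (M1_23 T y i1 i2 i3) = singular_value k (M2_13 T y i2 i1 i3).
Proof.
move=> i12; congr singular_value; rewrite /M1_23 /M2_13; congr unfold.
by apply/funext => a; apply/funext => b; apply/funext => c; exact: subtensor_swapl.
Qed.

Lemma singular_value_M2_31 k T y i1 i2 i3 :
  singular_value k (M2_31 T y i1 i2 i3) = singular_value k (M2_13 T y i1 i2 i3).
Proof. by rewrite /M2_31 singular_value_unfoldC. Qed.

Lemma singular_value_M3_12 k T y i1 i2 i3 : i2 != i3 ->
  singular_value k (M3_12 T y i1 i2 i3) = singular_value k (M2_13 T y i1 i3 i2).
Proof.
move=> i23; congr singular_value; rewrite /M3_12 /M2_13; congr unfold.
by apply/funext => c; apply/funext => a; apply/funext => b; exact: subtensor_swapr.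
Qed.

Lemma singular_value_M2_13C k T y i1 i2 i3 :
  i1 != i2 -> i1 != i3 -> i2 != i3 ->
  singular_value k (M2_13 T y i1 i2 i3) = singular_value k (M2_13 T y i3 i2 i1).
Proof.
move=> i12 i13 i23; rewrite /M2_13 singular_value_unfoldC.
congr singular_value; congr unfold.
apply/funext => a; apply/funext => b; apply/funext => c.
by rewrite (subtensor_swapl _ _ _ _ _ i12) (subtensor_swapr _ _ _ _ _ i13) subtensor_swapl.
Qed.

Lemma M2_13D T Z y i1 i2 i3 :
  M2_13 (fun x => T x + Z x) y i1 i2 i3 = M2_13 T y i1 i2 i3 + M2_13 Z y i1 i2 i3.
Proof.
apply/matrixP => b ac; case/mxvec_indexP: ac => a c.
by rewrite [RHS]mxE !unfoldE.
Qed.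

(** Injectivity of [psi] says that distinct entries of a matricized noise tensor are distinct noise
    variables, hence independent. *)
Lemma M2_13_entries y i1 i2 i3 : i1 != i2 -> i1 != i3 -> i2 != i3 ->
  exists psi : 'I_(n i2) * 'I_(n i1 * n i3) -> mindex n, injective psi /\
  forall Z, M2_13 Z y i1 i2 i3 = \matrix_(b, j) Z (psi (b, j)).
Proof.
move=> i12 i13 i23.
have i31 : i3 != i1 by rewrite eq_sym.
have i32 : i3 != i2 by rewrite eq_sym.
have i21 : i2 != i1 by rewrite eq_sym.
have [g gK Kg] := curry_mxvec_bij (n i1) (n i3).
pose psi (p : 'I_(n i2) * 'I_(n i1 * n i3)) : mindex n :=
  finfun (dfwith (dfwith (dfwith y i1 (g p.2).1) i2 p.1) i3 (g p.2).2).
exists psi; split=> [[b j] [b' j'] e|Z].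
  have e1 : (g j).1 = (g j').1.
    have := congr1 (fun x : mindex n => x i1) e; rewrite !ffunE/=.
    by rewrite 2?(@dfwithout _ _ _ i3)// 2?(@dfwithout _ _ _ i2)// !dfwithin.
  have e2 : b = b'.
    have := congr1 (fun x : mindex n => x i2) e; rewrite !ffunE/=.
    by rewrite 2?(@dfwithout _ _ _ i3)// !dfwithin.
  have e3 : (g j).2 = (g j').2.
    by have := congr1 (fun x : mindex n => x i3) e; rewrite !ffunE/= !dfwithin.
  congr pair; first exact: e2.
  by rewrite -(Kg j)// -(Kg j')// [g j]surjective_pairing [g j']surjective_pairing e1 e3.
apply/matrixP => b j; rewrite [RHS]mxE -{1}(Kg j)//.
by rewrite [g j]surjective_pairing /= unfoldE.
Qed.

(** [L] ignores the coordinates [i1] and [i3], while [G] ignores [i2]: the decomposition separates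
    rows from columns and factors the matrix through dimension [q]. *)
Lemma mxrank_M2_13 q T (L G : mindex n -> 'I_q -> R) y i1 i2 i3 :
  (forall x, T x = \sum_b L x b * G x b) ->
  (forall x x' : mindex n, x i2 = x' i2 ->
     (forall k, k != i1 -> k != i3 -> x k = x' k) -> L x =1 L x') ->
  (forall x x' : mindex n, (forall k, k != i2 -> x k = x' k) -> G x =1 G x') ->
  i1 != i2 -> i1 != i3 -> i2 != i3 ->
  (\rank (M2_13 T y i1 i2 i3) <= q)%N.
Proof.
move=> TE hL hG i12 i13 i23.
have i32 : i3 != i2 by rewrite eq_sym.
pose X a b c : mindex n := finfun (dfwith (dfwith (dfwith y i1 a) i2 b) i3 c).
(* Values [a0], [b0], [c0] are needed to fill the ignored coordinates; if one of the three modes is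
   empty, so is the matrix. *)
have [/card0_eq E0|] := posnP #|'I_(n i2)|.
  rewrite (_ : M2_13 _ _ _ _ _ = 0) ?mxrank0//.
  by apply/matrixP => b; have := E0 b; rewrite inE.
case/card_gt0P => b0 _.
have [/card0_eq E0|] := posnP #|'I_(n i1)|.
  rewrite (_ : M2_13 _ _ _ _ _ = 0) ?mxrank0//.
  apply/matrixP => b ac; case/mxvec_indexP: ac => a.
  by have := E0 a; rewrite inE.
case/card_gt0P => a0 _.
have [/card0_eq E0|] := posnP #|'I_(n i3)|.
  rewrite (_ : M2_13 _ _ _ _ _ = 0) ?mxrank0//.
  apply/matrixP => b ac; case/mxvec_indexP: ac => a c.
  by have := E0 c; rewrite inE.
case/card_gt0P => c0 _.
pose A : 'M[R]_(n i2, q) := \matrix_(b, t) L (X a0 b c0) t.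
pose B : 'M[R]_(q, n i1 * n i3) :=
  \matrix_t mxvec (\matrix_(a, c) G (X a b0 c) t).
have -> : M2_13 T y i1 i2 i3 = A *m B.
  apply/matrixP => b ac; case/mxvec_indexP: ac => a c.
  rewrite unfoldE /subtensor TE mxE; apply: eq_bigr => t _.
  rewrite !mxE mxvecE mxE; congr (_ * _).
    apply: hL => [|k k1 k3]; rewrite !ffunE.
      by rewrite 2?(@dfwithout _ _ _ i3)// !dfwithin.
    rewrite 2?(@dfwithout _ _ _ i3) 1?eq_sym//.
    have [k2|k2] := eqVneq i2 k; first by subst k; rewrite !dfwithin.
    by rewrite 2?(@dfwithout _ _ _ i2)// 2?(@dfwithout _ _ _ i1) 1?eq_sym.
  apply: hG => k k2; rewrite !ffunE.
  have [k3|k3] := eqVneq i3 k; first by subst k; rewrite !dfwithin.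
  by rewrite 2?(@dfwithout _ _ _ i3)// 2?(@dfwithout _ _ _ i2) 1?eq_sym.
apply: leq_trans (mxrankM_maxl _ _) (rank_leq_col _).
Qed.

End Matricizations.

Section ExtremeRank.
Variables (R : realType) (d : nat) (r n : 'I_d -> nat) (tau : 'S_d) (hd : (0 < d)%N).
Variables (u : tt_cores R r n tau) (K : nat).
Hypothesis r1 : forall j : 'I_d, val j = 0%N -> r j = 1%N.
Hypothesis rK : forall j : 'I_d, (0 < j)%N -> (r j < K)%N.

(** The cut is at the bond just right of [i2], hence the successor of its position: [i2] is on the
    left side, [i1] and [i3] are on the right. This bond exists because [i1] comes later. *)
Lemma mxrank_tt_first y i1 i2 i3 : i1 != i3 ->
  ((tau^-1 i2)%g < (tau^-1 i1)%g)%N -> ((tau^-1 i2)%g < (tau^-1 i3)%g)%N ->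
  (\rank (M2_13 (tt_entry hd u) y i1 i2 i3) < K)%N.
Proof.
move=> i13 p21 p23.
have kd : ((tau^-1 i2)%g.+1 < d)%N by exact: leq_ltn_trans p21 (ltn_ord _).
have [q [L [G [qr TE hL hG]]]] := tt_entry_split u hd (Ordinal kd) r1.
have neq (i j : 'I_d) : ((tau^-1 i)%g < (tau^-1 j)%g)%N -> j != i.
  by apply: contraTneq => ->; rewrite ltnn.
apply: leq_ltn_trans (rK (isT : (0 < Ordinal kd)%N)); rewrite -qr.
apply: (@mxrank_M2_13 R d n q (tt_entry hd u) L G y i1 i2 i3) => //.
- move=> x x' x2 xx'; apply: hL => j; rewrite ltnS leq_eqVlt => /orP[/eqP e|jp].
    by rewrite (_ : tau j = i2)// (_ : j = (tau^-1 i2)%g) ?permKV//; exact: val_inj.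
  apply: xx'; apply/eqP => e.
    by move: p21; rewrite -e permK ltnNge ltnW.
  by move: p23; rewrite -e permK ltnNge ltnW.
- move=> x x' xx'; apply: hG => j jp; apply: xx'.
  by apply/eqP => e; move: jp => /=; rewrite -e permK ltnn.
- exact: neq.
- by rewrite eq_sym neq.
Qed.

(** Mirror case: the cut is at the bond just left of [i2], numbered by the position of [i2] itself,
    and the two factors exchange roles. *)
Lemma mxrank_tt_last y i1 i2 i3 : i1 != i3 ->
  ((tau^-1 i1)%g < (tau^-1 i2)%g)%N -> ((tau^-1 i3)%g < (tau^-1 i2)%g)%N ->
  (\rank (M2_13 (tt_entry hd u) y i1 i2 i3) < K)%N.
Proof.
move=> i13 p12 p32.
pose kd := (tau^-1 i2)%g.
have [q [L [G [qr TE hL hG]]]] := tt_entry_split u hd kd r1.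
have neq (i j : 'I_d) : ((tau^-1 i)%g < (tau^-1 j)%g)%N -> j != i.
  by apply: contraTneq => ->; rewrite ltnn.
have k0 : (0 < kd)%N by exact: leq_ltn_trans p12.
apply: leq_ltn_trans (rK k0); rewrite -qr.
apply: (@mxrank_M2_13 R d n q (tt_entry hd u) G L y i1 i2 i3) => //.
- by move=> x; rewrite TE; apply: eq_bigr => b _; rewrite mulrC.
- move=> x x' x2 xx'; apply: hG => j; rewrite leq_eqVlt => /orP[/eqP e|jp].
    by rewrite (_ : tau j = i2)// (_ : j = (tau^-1 i2)%g) ?permKV//; exact: val_inj.
  apply: xx'; apply/eqP => e.
    by move: p12; rewrite -e permK ltnNge ltnW.
  by move: p32; rewrite -e permK ltnNge ltnW.
- move=> x x' xx'; apply: hL => j jp; apply: xx'.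
  by apply/eqP => e; move: jp; rewrite /kd -e permK ltnn.
- by rewrite eq_sym neq.
- exact: neq.
Qed.

End ExtremeRank.

(** * Absorbing the size of the net into the Gaussian exponent *)

Section NumericTail.
Variable R : realType.

(* The left-hand side bounds the sum over a grid net of mesh about [1 / (4 * S)]
   in dimension [k]; since [x ^+ 2 / 2] exceeds [t ^+ 2 / 8] by at least
   [t * N / 8 + N ^+ 2 / 32], it beats [O(t + N) ^ N]. *)
Definition tail_const (C : R) : Prop :=
  forall (N k : nat) (t S x : R), (4 <= N)%N -> (k <= N)%N -> 0 <= t ->
  S = (t + 3 * N%:R + 2 * Num.sqrt N%:R) / 2 ->
  t / 2 + N%:R / 4 <= x ->
  (((Num.truncn (4 * S)).+1.*2.+1 ^ k)%:R * expR (- (x ^+ 2 / 2)) <=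
   C * expR (- (8^-1 * t ^+ 2))).

Lemma tail_numeric : exists2 C : R, 0 < C & tail_const C.
Proof.
(* [1344 = 21 * 64] makes [c * (N / 64)] equal to [21 * N]; its product with [t / (4 * N)] is
   [21 / 4 * t], which exceeds [4 * t]. *)
have [c [c0 cE]] : exists c : R, 0 < c /\ c = 1344
  by exists 1344; split; [rewrite ltr0n|reflexivity].
pose K : R := ln c.
(* After all estimates [K * N - N ^+ 2 / 64] is left in the exponent, and completing the square
   bounds it by [16 * K ^+ 2]. The term [t / 4] is absorbed by [t * N / 8], as [N] is at least 4. *)
exists (expR (16 * K ^+ 2)); first exact: expR_gt0.
move=> N k t S x N4 kN t0 eS hx.
have NR : 4 <= N%:R :> R by rewrite (ler_nat _ 4).
have sN : Num.sqrt N%:R <= N%:R :> R.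
  rewrite -{2}(@sqr_sqrtr R N%:R)// expr2 ler_peMl ?sqrtr_ge0//.
  by rewrite -(ler_pXn2r (n := 2)) ?nnegrE ?sqrtr_ge0// expr1n sqr_sqrtr//; lra.
have S0 : 0 <= S by rewrite eS; have := sqrtr_ge0 (N%:R : R); lra.
set m := (_.*2.+1)%N.
have mle : m%:R <= 4 * t + 21 * N%:R :> R.
  have /andP[h _] := truncn_itv (mulr_ge0 (ler0n R 4) S0).
  rewrite /m -addn1 -muln2 -addn1 natrD natrM natrD.
  have : 4 * S <= 2 * t + 10 * N%:R by rewrite eS; lra.
  move=> h2; have := le_trans h h2; lra.
have m1 : 1 <= m%:R :> R by rewrite (ler_nat _ 1).
have step1 : (m ^ k)%:R <= (4 * t + 21 * N%:R) ^+ N :> R.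
  rewrite natrX; apply: le_trans (ler_weXn2l m1 kN) _.
  by apply: lerXn2r => //; rewrite nnegrE; lra.
(* The inequality [1 + x <= expR x] is applied to [N / 64] and to [t / (4 * N)] separately, so that
   the [N]-th power costs only [N ^+ 2 / 64] and [t / 4], both below what the exponent gains. *)
have step2 : (4 * t + 21 * N%:R) ^+ N <= expR (t / 4 + K * N%:R + N%:R ^+ 2 / 64) :> R.
  have e1 : 4 * t + 21 * N%:R <= (c * expR (N%:R / 64)) * expR (t / (4 * N%:R)).
    have h1 : N%:R / 64 <= expR (N%:R / 64) :> R.
      by apply: le_trans (expR_ge1Dx _); lra.
    have h2 : 1 + t / (4 * N%:R) <= expR (t / (4 * N%:R)) := expR_ge1Dx _.
    have h3 : 4 * t + 21 * N%:R <= (c * (N%:R / 64)) * (1 + t / (4 * N%:R)).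
      have -> : (c * (N%:R / 64)) * (1 + t / (4 * N%:R)) = 21 * N%:R + 21 / 4 * t.
        by rewrite cE; field; lra.
      lra.
    have p1 : 0 <= 1 + t / (4 * N%:R) by rewrite addr_ge0// divr_ge0//; lra.
    have p2 : 0 <= c * (N%:R / 64) by rewrite mulr_ge0 ?(ltW c0)// divr_ge0.
    apply: (le_trans h3); apply: (ler_pM p2 p1 _ h2).
    by rewrite (ler_pM2l c0).
  apply: le_trans (lerXn2r _ _ _ e1) _; rewrite ?nnegrE;
    [lra|by rewrite !mulr_ge0 ?expR_ge0 ?(ltW c0)|].
  rewrite 2!exprMn -!expRM_natl.
  have -> : c ^+ N = expR (K * N%:R) :> R.
    by rewrite mulrC expRM_natl lnK.
  rewrite -!expRD ler_expR le_eqVlt; apply/orP; left; apply/eqP.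
  by field; lra.
have hx2 : (t / 2 + N%:R / 4) ^+ 2 <= x ^+ 2.
  by rewrite ler_pXn2r// nnegrE; lra.
apply: le_trans (ler_wpM2r (expR_ge0 _) (le_trans step1 step2)) _.
rewrite -!expRD ler_expR.
have : 0 <= (N%:R / 8 - 4 * K) ^+ 2 by exact: sqr_ge0.
have : 0 <= t * (N%:R - 4) by rewrite mulr_ge0//; lra.
move: hx2; rewrite !expr2 => h1 h2 h3.
nra.
Qed.

End NumericTail.

(** * Error-free runs: correctness and number of calls *)

Section TrainRecoveryCorrect.
Variable d : nat.
Implicit Types (p : 'I_d -> nat) (i : 'I_d) (s : seq 'I_d).

(** Positions are given by an arbitrary function [p], so that the reversed order can be treated by
    the same lemmas. *)
Definition between p i1 i2 i3 : bool :=
  ((p i1 < p i2 < p i3) || (p i3 < p i2 < p i1))%N.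

Definition ideal_call p i1 i2 i3 : option ('I_d * 'I_d * 'I_d) :=
  if between p i2 i1 i3 then Some (i2, i1, i3)
  else if between p i1 i2 i3 then Some (i1, i2, i3)
  else Some (i2, i3, i1).

Definition distinct3 (x : 'I_d * 'I_d * 'I_d) : bool :=
  [&& x.1.1 != x.1.2, x.1.1 != x.2 & x.1.2 != x.2].

(* A run is adaptive, but the queries of a run that is always answered correctly
   are fixed in advance: agreement on that list of queries forces the output. *)
Definition agrees (call : nat -> 'I_d -> 'I_d -> 'I_d -> option ('I_d * 'I_d * 'I_d))
    p (v : nat * ('I_d * 'I_d * 'I_d)) : Prop :=
  call v.1 v.2.1.1 v.2.1.2 v.2.2 = ideal_call p v.2.1.1 v.2.1.2 v.2.2.

Let ltp p : rel 'I_d := fun a b => (p a < p b)%N.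

Let ltp_trans p : transitive (ltp p).
Proof. by move=> a b c; exact: ltn_trans. Qed.

Let sorted_pos p s t : sorted (ltp p) s -> t \notin s -> injective p ->
  let pos := find (fun a => (p t < p a)%N) s in
  forall j, (j < size s)%N ->
    (if j < pos then p (nth t s j) < p t else p t < p (nth t s j))%N.
Proof.
move=> ss ts pI pos j js; case: ifPn => [jp|]; last rewrite -leqNgt => jp.
  have /= := before_find t jp; rewrite ltnNge => /negbFE.
  rewrite leq_eqVlt => /orP[/eqP/pI e|//].
  by rewrite -e mem_nth in ts.
have hpos : has (fun a => (p t < p a)%N) s by rewrite has_find (leq_ltn_trans jp).
have h := nth_find t hpos; move: jp; rewrite leq_eqVlt => /orP[/eqP <- //|jp].
apply: ltn_trans h _.
by apply: (sorted_ltn_nth (@ltp_trans p) t ss) => //; rewrite inE -has_find.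
Qed.

(** The invariant is [jmin <= pos < jmax], where [pos] is the number of entries of [s] before [t].
    Whichever third is kept, a length of at most [2 ^ c.+1] drops to at most [2 ^ c], so [c] calls
    suffice. [V] and [k'] are chosen before [call]: the queries are fixed in advance. *)
Lemma locate_correct p s t (c : nat) : injective p -> sorted (ltp p) s -> t \notin s ->
  (2 <= size s)%N ->
  let pos := find (fun a => (p t < p a)%N) s in
  forall fuel k jmin jmax, (jmin <= pos < jmax)%N -> (jmax <= (size s).+1)%N ->
    (jmax - jmin <= 2 ^ c)%N -> (jmax - jmin <= fuel)%N ->
  exists V k', [/\ (size V <= c)%N, all (fun v => distinct3 v.2) V &
    forall call, (forall v, v \in V -> agrees call p v) ->
      locate call s t fuel k jmin jmax = Some (k', pos, pos.+1)].
Proof.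
move=> pI ss ts s2 pos.
elim: c => [|c IH] fuel k jmin jmax /andP[h1 h2] h3 h4 h5.
  exists [::], k; split => // call _.
  have [e1 e2] : jmin = pos /\ jmax = pos.+1 by lia.
  case: fuel h5 => [|fuel] h5 /=; first by rewrite e1 e2.
  by rewrite (_ : (2 <= jmax - jmin)%N = false) ?e1 ?e2//; lia.
case: fuel h5 => [|fuel] h5; first by lia.
have [m2|m2] := leqP 2 (jmax - jmin); last first.
  have [e1 e2] : jmin = pos /\ jmax = pos.+1 by lia.
  exists [::], k; split => // call _ /=.
  by rewrite (_ : (2 <= jmax - jmin)%N = false) ?e1 ?e2//; lia.
case E : (probes jmin jmax) => [j1 j2].
have hp2 : (2 ^ c.+1 = 2 * 2 ^ c)%N by rewrite expnS.
have [b1 b2 b3 l1 [l2 l3]] : [/\ (1 <= j1)%N, (j1 < j2)%N, (j2 <= size s)%N,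
    (pos < j1 -> j1 - jmin <= 2 ^ c /\ j1 - jmin <= fuel)%N &
    (j1 <= pos < j2 -> j2 - j1 <= 2 ^ c /\ j2 - j1 <= fuel)%N /\
    (j2 <= pos -> jmax - j2 <= 2 ^ c /\ jmax - j2 <= fuel)%N].
  move: E; rewrite /probes; case: ifPn => m3.
    by case=> <- <-; split; [| | | |split]; lia.
  by case: ifPn => j0 [<- <-]; (split; [| | | |split]); lia.
set a := nth t s j1.-1; set b := nth t s j2.-1.
have sp := sorted_pos ss ts pI.
have j1s : (j1.-1 < size s)%N by lia.
have j2s : (j2.-1 < size s)%N by lia.
have ab : (p a < p b)%N.
  by apply: (sorted_ltn_nth (@ltp_trans p) t ss) => //; rewrite ?inE; lia.
have ta : t != a by apply: contraNneq ts => ->; exact: mem_nth.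
have tb : t != b by apply: contraNneq ts => ->; exact: mem_nth.
have ab' : a != b by apply: contraTneq ab => ->; rewrite ltnn.
have d3 : distinct3 (t, a, b) by rewrite /distinct3/= ta tb.
have := sp _ j1s; have := sp _ j2s; rewrite -/a -/b -/pos => hb ha.
have [p1|p1] := ltnP pos j1.
  have pt : (p t < p a)%N by move: ha; rewrite ifF//; clear -p1 b1; lia.
  have q1 : (jmin <= pos < j1)%N by clear -h1 h2 p1; lia.
  have q2 : (j1 <= (size s).+1)%N by clear -b2 b3; lia.
  have [V [k' [sV aV HV]]] := IH fuel k.+1 jmin j1 q1 q2 (l1 p1).1 (l1 p1).2.
  exists ((k, (t, a, b)) :: V), k'; split => [//||call agr]; first by rewrite /= d3.
  rewrite /= m2 E -/a -/b.
  rewrite [call k t a b](agr (k, (t, a, b)) (mem_head _ _))/= /ideal_call /between.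
  have -> : ((p a < p t < p b) || (p b < p t < p a))%N = false by clear -ab pt; lia.
  have -> : ((p t < p a < p b) || (p b < p a < p t))%N = true by clear -ab pt; lia.
  by rewrite eqxx/= HV// => v vV; apply: agr; rewrite inE vV orbT.
have [p2|p2] := ltnP pos j2.
  have pt : (p a < p t)%N by move: ha; rewrite ifT//; clear -p1 p2 b1 b2; lia.
  have pt' : (p t < p b)%N by move: hb; rewrite ifF//; clear -p1 p2 b1 b2; lia.
  have p12 : (j1 <= pos < j2)%N by rewrite p1.
  have q1 : (j1 <= pos < j2)%N by clear -h1 h2 p1 p2; lia.
  have q2 : (j2 <= (size s).+1)%N by clear -b3; lia.
  have [V [k' [sV aV HV]]] := IH fuel k.+1 j1 j2 q1 q2 (l2 p12).1 (l2 p12).2.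
  exists ((k, (t, a, b)) :: V), k'; split => [//||call agr]; first by rewrite /= d3.
  rewrite /= m2 E -/a -/b.
  rewrite [call k t a b](agr (k, (t, a, b)) (mem_head _ _))/= /ideal_call /between.
  have -> : ((p a < p t < p b) || (p b < p t < p a))%N = true by clear -ab pt pt'; lia.
  rewrite !xpair_eqE !eqxx (eq_sym a t) (negbTE ta) (negbTE ab')/=.
  by rewrite HV// => v vV; apply: agr; rewrite inE vV orbT.
have pt : (p b < p t)%N by move: hb; rewrite ifT//; clear -p1 p2 b1 b2; lia.
have q1 : (j2 <= pos < jmax)%N by clear -h1 h2 p1 p2; lia.
  have q2 : (jmax <= (size s).+1)%N by exact: h3.
  have [V [k' [sV aV HV]]] := IH fuel k.+1 j2 jmax q1 q2 (l3 p2).1 (l3 p2).2.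
exists ((k, (t, a, b)) :: V), k'; split => [//||call agr]; first by rewrite /= d3.
rewrite /= m2 E -/a -/b.
rewrite [call k t a b](agr (k, (t, a, b)) (mem_head _ _))/= /ideal_call /between.
have -> : ((p a < p t < p b) || (p b < p t < p a))%N = false by clear -ab pt; lia.
have -> : ((p t < p a < p b) || (p b < p a < p t))%N = false by clear -ab pt; lia.
rewrite !xpair_eqE (eq_sym a t) (eq_sym b t) (negbTE ta) (negbTE ab') (negbTE tb)/= andbF/=.
by rewrite HV// => v vV; apply: agr; rewrite inE vV orbT.
Qed.

Lemma insert_all_cons call t ts k s :
  insert_all call (t :: ts) k s =
  if locate call s t t.+1 k 0 t.+1 is Some (k', jmin, jmax) then
    insert_all call ts k' (take jmin s ++ t :: drop jmax.-1 s)
  else None.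
Proof. by []. Qed.

(** Between insertions the list is sorted by [p] and holds exactly the indices below its size; each
    insertion starts from an interval of length at most [d], hence costs at most [c] calls. *)
Lemma insert_all_correct p (c : nat) ts : injective p -> (d <= 2 ^ c)%N ->
  forall k s, sorted (ltp p) s -> (2 <= size s)%N ->
    (forall i, (i \in s) = (i < size s)%N) ->
    map val ts = iota (size s) (size ts) ->
  exists V s', [/\ (size V <= c * size ts)%N, all (fun v => distinct3 v.2) V,
    sorted (ltp p) s', (forall i, (i \in s') = (i < size s + size ts)%N) &
    forall call, (forall v, v \in V -> agrees call p v) ->
      insert_all call ts k s = Some s'].
Proof.
move=> pI dc; elim: ts => [|t ts IH] k s ss s2 ms /=.
  by exists [::], s; split => // i; rewrite ms addn0.
case=> tE tsE.
have tns : t \notin s by rewrite ms tE ltnn.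
set pos := find (fun a => (p t < p a)%N) s.
have posS : (pos <= size s)%N by exact: find_size.
have [||||V1 [k' [sV1 dV1 H1]]] := @locate_correct p s t c pI ss tns s2 t.+1 k 0 t.+1.
- by rewrite tE ltnS.
- by rewrite tE.
- by rewrite subn0; exact: leq_trans (ltn_ord t) dc.
- by rewrite subn0.
pose s1 := take pos s ++ t :: drop pos s.
have sz1 : size s1 = (size s).+1.
  by rewrite size_cat/= addnS -size_cat cat_take_drop.
have ps1 : perm_eq s1 (t :: s).
  by rewrite -[s in t :: s](cat_take_drop pos) perm_catC perm_cons perm_catC.
have sp := sorted_pos ss tns pI.
have ss1 : sorted (ltp p) s1.
  have adj := ss; rewrite -(cat_take_drop pos s) in adj.
  rewrite /s1 (sorted_pairwise (@ltp_trans p)) pairwise_cat/=.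
  rewrite (sorted_pairwise (@ltp_trans p)) pairwise_cat in adj.
  case/and3P: adj => a1 a2 a3; rewrite a2 a3 andbT.
  have tk a : a \in take pos s -> (p a < p t)%N.
    move=> /(nthP t)[j]; rewrite size_take_min leq_min => /andP[j1 j2] <-.
    by rewrite nth_take//; have := sp j j2; rewrite -/pos j1.
  have td a : a \in drop pos s -> (p t < p a)%N.
    move=> /(nthP t)[j]; rewrite size_drop ltn_subRL => j1 <-.
    by rewrite nth_drop; have := sp _ j1; rewrite -/pos ltnNge leq_addr.
  rewrite /=; apply/andP; split.
    rewrite allrel_consr; apply/andP; split=> //; exact/allP.
  by apply/allP.
have ms1 i : (i \in s1) = (i < size s1)%N.
  by rewrite (perm_mem ps1) inE ms sz1 ltnS [RHS]leq_eqVlt -tE.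
have [|||V2 [s' [sV2 dV2 ss' ms' H2]]] := IH k' s1 ss1.
- by rewrite sz1 ltnW.
- exact: ms1.
- by rewrite sz1.
exists (V1 ++ V2), s'; split => //.
- by rewrite size_cat mulnS leq_add.
- by rewrite all_cat dV1.
- by move=> i; rewrite ms' sz1 addSnnS.
move=> call agr; rewrite -[LHS]/(insert_all call (t :: ts) k s) insert_all_cons.
rewrite H1 => [|v vV]; last by apply: agr; rewrite mem_cat vV.
by rewrite H2// => v vV; apply: agr; rewrite mem_cat vV orbT.
Qed.


Lemma pick_codom (tau : 'S_d) : [pick t : 'S_d | codom t == codom tau] = Some tau.
Proof.
case: pickP => [t /eqP|/(_ tau)]; last by rewrite eqxx.
rewrite !codomE => /eq_in_map e; congr Some; apply/permP => j.
by apply: e; rewrite mem_enum.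
Qed.

Lemma sorted_codom p (tau : 'S_d) s : (forall j, p (tau j) = j) ->
  sorted (ltp p) s -> (forall i, i \in s) -> s = codom tau.
Proof.
move=> pt ss ms; apply: (irr_sorted_eq (@ltp_trans p)) => //.
- by move=> a; exact: ltnn.
- rewrite codomE sorted_map; have : sorted ltn (map val (enum 'I_d)).
    by rewrite val_enum_ord iota_ltn_sorted.
  by rewrite sorted_map; apply: sub_sorted => a b /=; rewrite /ltp !pt.
- by move=> i; rewrite ms -(permKV tau i) codom_f.
Qed.

(** Betweenness is symmetric under reversal, so no query can tell [tau] from its reversal; this is
    why the answer is a class of two permutations. *)
Lemma ideal_call_rev p p' : (forall i j, (p' i < p' j)%N = (p j < p i)%N) ->
  forall i1 i2 i3, ideal_call p' i1 i2 i3 = ideal_call p i1 i2 i3.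
Proof.
move=> h i1 i2 i3; have e x y z : between p' x y z = between p x y z.
  by rewrite /between !h orbC andbC; congr (_ || _); rewrite andbC.
by rewrite /ideal_call !e.
Qed.

Lemma train_recovery_correct (tau : 'S_d) (c : nat) : (3 <= d)%N -> (d <= 2 ^ c)%N ->
  let p := fun i => val ((tau^-1)%g i) in
  exists V, [/\ (size V <= 1 + c * d)%N, all (fun v => distinct3 v.2) V &
    forall call, (forall v, v \in V -> agrees call p v) ->
      exists2 tau', train_recovery call = Some tau' & tau' \in TT_class tau].
Proof.
move=> d3 dc p.
have pI : injective p by move=> i j /val_inj /perm_inj.
pose p' i := (d.-1 - p i)%N.
have pd i : (p i < d)%N by exact: ltn_ord.
have hp' i j : (p' i < p' j)%N = (p j < p i)%N.
  by have := pd i; have := pd j; rewrite /p'; lia.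
have p'I : injective p'.
  by move=> i j e; apply: pI; have := pd i; have := pd j; move: e; rewrite /p'; lia.
have := val_enum_ord d; have := size_enum_ord d.
rewrite /train_recovery /train_list; case E : (enum 'I_d) => [|a [|b [|e ts]]] //= sz;
  try by rewrite -sz in d3.
move=> vE.
have e0 : iota 0 d = [:: 0, 1, 2 & iota 3 (size ts)]%N by rewrite -[X in iota 0 X]sz.
move: vE; rewrite e0 => -[va vb ve vts].
have [ab ae be] : [/\ a != b, a != e & b != e] by rewrite -!val_eqE /= va vb ve.
have [pab pae pbe] : [/\ p a != p b, p a != p e & p b != p e] by rewrite !(inj_eq pI).
pose conclusion := exists V : seq (nat * ('I_d * 'I_d * 'I_d)),
  [/\ (size V <= 1 + c * d)%N, all (fun v => distinct3 v.2) V &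
    forall call, (forall v, v \in V -> agrees call p v) ->
      exists2 tau',
        (if (if call 0%N a b e is Some (i1, i2, i3)
             then insert_all call ts 1 [:: i1; i2; i3] else None) is Some s
         then [pick t : 'S_d | codom t == s] else None) = Some tau' &
        tau' \in TT_class tau].
(* [q] is whichever of [p] and its reversal [p'] makes the first returned triple increasing. All
   later insertions keep the list increasing for [q], so the final list enumerates the matching
   member [tau'] of the class. *)
have finish (q : 'I_d -> nat) (tau' : 'S_d) x1 x2 x3 :
    injective q -> (forall j, q (tau' j) = j) ->
    (forall i1 i2 i3, ideal_call q i1 i2 i3 = ideal_call p i1 i2 i3) ->
    tau' \in TT_class tau -> ideal_call p a b e = Some (x1, x2, x3) ->
    perm_eq [:: x1; x2; x3] [:: a; b; e] -> (q x1 < q x2)%N -> (q x2 < q x3)%N ->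
    conclusion.
  move=> qI qt qp t'C idE pe q12 q23.
  have ss : sorted (ltp q) [:: x1; x2; x3] by rewrite /= /ltp q12 q23.
  have ms i : (i \in [:: x1; x2; x3]) = (i < 3)%N.
    rewrite (perm_mem pe) !inE -!val_eqE /= va vb ve.
    by case: (nat_of_ord i) => [|[|[|]]].
  have [|V [s' [sV dV ss' ms' HV]]] := @insert_all_correct q c ts qI dc 1 _ ss isT ms.
    exact: vts.
  exists ((0%N, (a, b, e)) :: V); split=> [||call agr].
  - rewrite /= add1n ltnS; apply: leq_trans sV _; rewrite leq_mul2l.
    by apply/orP; right; rewrite -[X in (_ <= X)%N]sz -addn3 leq_addr.
  - by rewrite /= /distinct3/= ab ae be.
  have e1 : call 0%N a b e = Some (x1, x2, x3).
    by rewrite -idE; exact: (agr (0%N, (a, b, e)) (mem_head _ _)).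
  have e2 : insert_all call ts 1 [:: x1; x2; x3] = Some s'.
    apply: HV => v vV; rewrite /agrees qp; apply: agr.
    by rewrite inE vV orbT.
  exists tau' => //; rewrite e1 e2.
  suff -> : s' = codom tau' by exact: pick_codom.
  apply: (@sorted_codom q) => // i.
  by rewrite ms' /= (_ : (3 + size ts)%N = d)// ltn_ord.
have tC : tau \in TT_class tau by rewrite !inE eqxx.
have rC : (rev_perm d * tau)%g \in TT_class tau by rewrite !inE eqxx orbT.
have pt j : p (tau j) = j by rewrite /p permK.
have pt' j : p' ((rev_perm d * tau)%g j) = j.
  by rewrite /p' permM pt permE /=; have := ltn_ord j; lia.
have pp' := ideal_call_rev hp'.
rewrite -/conclusion.
have [h|h] := boolP (between p b a e).
  have idE : ideal_call p a b e = Some (b, a, e) by rewrite /ideal_call h.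
  have pe : perm_eq [:: b; a; e] [:: a; b; e] by rewrite (perm_catCA [:: b] [:: a] [:: e]).
  case/orP: h => /andP[h1 h2].
    exact: (finish p tau b a e pI pt).
  by apply: (finish p' (rev_perm d * tau)%g b a e p'I pt') => //; rewrite hp'.
have [h'|h'] := boolP (between p a b e).
  have idE : ideal_call p a b e = Some (a, b, e) by rewrite /ideal_call (negbTE h) h'.
  case/orP: h' => /andP[h1 h2].
    exact: (finish p tau a b e pI pt).
  by apply: (finish p' (rev_perm d * tau)%g a b e p'I pt') => //; rewrite hp'.
have idE : ideal_call p a b e = Some (b, e, a).
  by rewrite /ideal_call (negbTE h) (negbTE h').
have pe : perm_eq [:: b; e; a] [:: a; b; e] by rewrite -(perm_rot 2) perm_sym /rot.
have : ((p b < p e) && (p e < p a) || (p a < p e) && (p e < p b))%N.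
  by move: h h' pab pae pbe; rewrite /between; clear; lia.
case/orP=> /andP[h1 h2].
  exact: (finish p tau b e a pI pt).
by apply: (finish p' (rev_perm d * tau)%g b e a p'I pt') => //; rewrite hp'.
Qed.

End TrainRecoveryCorrect.

(** * Measurability of the recovered ordering *)

Section Measurability.
Context (R : realType) d (T : measurableType d).

Lemma measurable_fun_lt (f : T -> R) :
  (forall c, measurable [set w | f w < c]) -> measurable_fun setT f.
Proof.
move=> h; apply: (measurability _ (RGenInftyO.measurableE R)) => _ [_ [c ->] <-].
rewrite setTI; have -> : f @^-1` `]-oo, c[%classic = [set w | f w < c].
  by apply/seteqP; split => w /=; rewrite in_itv.
exact: h.
Qed.

Lemma countType_bigcup_measurable (A : countType) (F : A -> set T) :
  (forall a, measurable (F a)) -> measurable (\bigcup_a F a).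
Proof. by apply: countable_bigcupT_measurable; exact: countableP. Qed.

(* A Lipschitz function is the infimum of countably many translates of the norm. *)
Lemma measurable_singular_value m p (M : T -> 'M[R]_(m, p)) k : (0 < k)%N ->
  (forall i j, measurable_fun setT (fun w => M w i j)) ->
  measurable_fun setT (fun w => singular_value k (M w)).
Proof.
move=> k0 mM; apply: measurable_fun_lt => c.
pose D (Q : 'M[rat]_(m, p)) w : R := \sum_i \sum_j `|M w i j - ratr (Q i j)|.
pose QR (Q : 'M[rat]_(m, p)) : 'M[R]_(m, p) := map_mx ratr Q.
have DE Q w : D Q w = \sum_i \sum_j `|(M w - QR Q) i j|.
  by apply: eq_bigr => i _; apply: eq_bigr => j _; rewrite !mxE.
have DE' Q w : D Q w = \sum_i \sum_j `|(QR Q - M w) i j|.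
  by apply: eq_bigr => i _; apply: eq_bigr => j _; rewrite !mxE distrC.
have -> : [set w | singular_value k (M w) < c] =
    \bigcup_(Q : 'M[rat]_(m, p)) [set w | singular_value k (QR Q) + D Q w < c].
  apply/seteqP; split => w /=; last first.
    move=> [Q _ /=]; apply: le_lt_trans; rewrite DE; exact: singular_value_lipschitz.
  (* The distance [D Q w] is lost twice, once in the sum and once in comparing the singular values,
     and consists of [m * p] entries; the successor keeps the denominator positive and the final
     inequality strict. *)
  move=> h; pose e := (c - singular_value k (M w)) / (2 * (m * p).+1%:R).
  have e0 : 0 < e by rewrite divr_gt0 ?subr_gt0// mulr_gt0.
  have q i j : exists q : rat, `|M w i j - ratr q| < e.
    have /rat_in_itvoo[q] : M w i j - e < M w i j + e by lra.
    rewrite in_itv/= => /andP[q1 q2]; exists q; rewrite ltr_norml; apply/andP; split; lra.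
  exists (\matrix_(i, j) sval (cid (q i j))) => //=; set Q := \matrix_(_, _) _.
  have hD : D Q w <= (m * p)%:R * e.
    apply: (@le_trans _ _ (\sum_(i < m) \sum_(j < p) e)).
      apply: ler_sum => i _; apply: ler_sum => j _; rewrite mxE ltW//.
      exact: svalP (cid (q i j)).
    rewrite (eq_bigr (fun=> e *+ p)) => [|i _]; last by rewrite sumr_const card_ord.
    by rewrite sumr_const card_ord -mulrnA mulnC [leRHS]mulr_natl.
  have hS : singular_value k (QR Q) <= singular_value k (M w) + D Q w.
    by rewrite DE'; exact: singular_value_lipschitz.
  have he : 2 * ((m * p).+1%:R * e) = c - singular_value k (M w).
    by rewrite mulrA mulrC divfK// mulf_neq0// pnatr_eq0.
  have he' : 2 * ((m * p)%:R * e) < 2 * ((m * p).+1%:R * e).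
    by rewrite ltr_pM2l// ltr_pM2r// ltr_nat.
  lra.
apply: countType_bigcup_measurable => Q; apply: measurable_lt_set => //.
apply: measurable_funD => //; apply: measurable_sum => i; apply: measurable_sum => j.
by apply: measurableT_comp => //; exact: measurable_funB.
Qed.

(** All subsets of the target are tested, so lists, options and permutations need no sigma-algebra
    and composing with any function is free. *)
Definition discrete_rv (A : Type) (f : T -> A) : Prop :=
  forall B : set A, measurable (f @^-1` B).

Lemma discrete_cst (A : Type) (a : A) : discrete_rv (fun=> a).
Proof.
move=> B; have [Ba|nBa] := pselect (B a).
  by rewrite (_ : _ @^-1` _ = setT)//; apply/seteqP; split.
by rewrite (_ : _ @^-1` _ = set0)//; apply/seteqP; split.
Qed.

Lemma discrete_if (A : Type) (b : T -> bool) (f g : T -> A) :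
  measurable [set w | b w] -> discrete_rv f -> discrete_rv g ->
  discrete_rv (fun w => if b w then f w else g w).
Proof.
move=> mb mf mg B.
have -> : (fun w => if b w then f w else g w) @^-1` B =
   ([set w | b w] `&` f @^-1` B) `|` (~` [set w | b w] `&` g @^-1` B).
  apply/seteqP; split => w /=; case: (b w) => //=; [by left|by right|by case=> [[]|[]]|].
  by case=> [[]|[]].
by apply: measurableU; apply: measurableI => //; exact: measurableC.
Qed.

(** One adaptive step: the continuation depends on the outcome, and a countable union over outcomes
    decouples them. *)
Lemma discrete_bind (A : countType) (B : Type) (f : T -> A) (g : A -> T -> B) :
  discrete_rv f -> (forall a, discrete_rv (g a)) -> discrete_rv (fun w => g (f w) w).
Proof.
move=> mf mg C.
have -> : (fun w => g (f w) w) @^-1` C =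
    \bigcup_(a : A) (f @^-1` [set a] `&` (g a) @^-1` C).
  apply/seteqP; split => w /=; first by move=> h; exists (f w).
  by move=> [a _ [/= <-]].
apply: countType_bigcup_measurable => a.
by apply: measurableI; [exact: mf|exact: mg].
Qed.

Lemma discrete_map (A B : Type) (f : T -> A) (g : A -> B) :
  discrete_rv f -> discrete_rv (fun w => g (f w)).
Proof. by move=> mf C; exact: (mf (g @^-1` C)). Qed.

Lemma discrete_finType (A : finType) (f : T -> A) :
  (forall a, measurable (f @^-1` [set a])) -> discrete_rv f.
Proof.
move=> h B; have -> : f @^-1` B = \bigcup_(a in B) (f @^-1` [set a]).
  by apply/seteqP; split => w /=; [move=> ?; exists (f w)|move=> [a Ba ->]].
by apply: fin_bigcup_measurable => [|a _]; [exact: finite_finset|exact: h].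
Qed.

Section Recovery.
Variable D : nat.
Variable call : T -> nat -> 'I_D -> 'I_D -> 'I_D -> option ('I_D * 'I_D * 'I_D).
Hypothesis mcall : forall k i1 i2 i3, discrete_rv (fun w => call w k i1 i2 i3).

Lemma discrete_locate s t fuel k jmin jmax :
  discrete_rv (fun w => locate (call w) s t fuel k jmin jmax).
Proof.
elim: fuel k jmin jmax => [|fuel IH] k jmin jmax /=; first exact: discrete_cst.
case: (2 <= jmax - jmin)%N; last exact: discrete_cst.
case: (probes jmin jmax) => j1 j2.
apply: (@discrete_bind _ _ (fun w => call w k t (nth t s j1.-1) (nth t s j2.-1))
  (fun a w => if a is Some out then
     if (out == (t, nth t s j1.-1, nth t s j2.-1)) ||
        (out == (nth t s j2.-1, nth t s j1.-1, t))
     then locate (call w) s t fuel k.+1 jmin j1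
     else if (out == (nth t s j1.-1, t, nth t s j2.-1)) ||
             (out == (nth t s j2.-1, t, nth t s j1.-1))
     then locate (call w) s t fuel k.+1 j1 j2
     else locate (call w) s t fuel k.+1 j2 jmax else None)).
  exact: mcall.
case=> [out|]; last exact: discrete_cst.
case: (_ || _); first exact: IH.
by case: (_ || _); exact: IH.
Qed.

Lemma discrete_insert_all ts k s : discrete_rv (fun w => insert_all (call w) ts k s).
Proof.
elim: ts k s => [|t ts IH] k s; first exact: discrete_cst.
apply: (@discrete_bind _ _ (fun w => locate (call w) s t t.+1 k 0 t.+1)
  (fun a w => if a is Some (k', jmin, jmax) then
    insert_all (call w) ts k' (take jmin s ++ t :: drop jmax.-1 s) else None)).
  exact: discrete_locate.
by case=> [[[k' jmin] jmax]|]; [exact: IH|exact: discrete_cst].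
Qed.

Lemma discrete_train_recovery : discrete_rv (fun w => train_recovery (call w)).
Proof.
apply: (@discrete_map _ _ (fun w => train_list (call w))
  (fun o => if o is Some s then [pick t : 'S_D | codom t == s] else None)).
rewrite /train_list; case: (enum 'I_D) => [|a [|b [|c ts]]]; try exact: discrete_cst.
apply: (@discrete_bind _ _ (fun w => call w 0%N a b c)
  (fun x w => if x is Some (i1, i2, i3)
     then insert_all (call w) ts 1 [:: i1; i2; i3] else None)).
  exact: mcall.
by case=> [[[i1 i2] i3]|]; [exact: discrete_insert_all|exact: discrete_cst].
Qed.

End Recovery.

Lemma discrete_three_index (D : nat) (n : 'I_D -> nat) (K : nat)
    (Z : T -> mindex n -> R) (y : mindex n) i1 i2 i3 : (0 < K)%N ->
  (forall x, measurable_fun setT (fun w => Z w x)) ->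
  discrete_rv (fun w => three_index K (Z w) y i1 i2 i3).
Proof.
move=> K0 mZ; have K20 : (0 < K ^ 2)%N by rewrite expn_gt0 K0.
have mU p q s (F : T -> 'I_p -> 'I_q -> 'I_s -> R) :
    (forall a b c, measurable_fun setT (fun w => F w a b c)) ->
    measurable_fun setT (fun w => singular_value (K ^ 2) (unfold (F w))).
  move=> mF; apply: measurable_singular_value => // a j.
  case/mxvec_indexP: j => b c; under eq_fun do rewrite unfoldE.
  exact: mF.
have ma : measurable_fun setT (fun w => singular_value (K ^ 2) (M1_23 (Z w) y i1 i2 i3)).
  by apply: mU => a b c; exact: mZ.
have mb : measurable_fun setT (fun w => singular_value (K ^ 2) (M2_31 (Z w) y i1 i2 i3)).
  by apply: mU => a b c; exact: mZ.
have mc : measurable_fun setT (fun w => singular_value (K ^ 2) (M3_12 (Z w) y i1 i2 i3)).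
  by apply: mU => a b c; exact: mZ.
rewrite /three_index; do 3 (apply: discrete_if;
  [apply: measurable_lt_set => //; exact: measurable_maxr|exact: discrete_cst|]).
exact: discrete_cst.
Qed.

End Measurability.

(** * The bad event of one call with fixed sampled coordinates *)

Section CallEvent.
Context (R : realType) d (Omega : measurableType d) (P : probability Omega R).

Definition noise_sets (I : Type) (X : I -> {RV P >-> R}) : set (set Omega) :=
  [set B | exists i D, measurable D /\ B = X i @^-1` D].

Lemma measurable_noise_sets (I : Type) (X : I -> {RV P >-> R}) (B : set Omega) :
  <<s noise_sets X >> B -> measurable B.
Proof.
apply: smallest_sub; first exact: sigma_algebra_measurable.
move=> _ [i [D [mD ->]]]; rewrite -[_ @^-1` _]setTI; exact: (measurable_funP (X i)).
Qed.

(** The measurability lemma is applied to the same sample space equipped with the sigma-algebra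
    generated by the noise; this membership gives access to the independence of the sampled
    coordinates. *)
Lemma noise_sets_net_bad (I : eqType) (X : I -> {RV P >-> R}) k l m q M
    (phi : 'I_m * 'I_q -> I) (X0 : 'M[R]_(k, m)) (V0 : 'M[R]_(l, q)) (s : R) :
  <<s noise_sets X >>
    (net_bad M (fun w => X0 *m (\matrix_(a, b) X (phi (a, b)) w) *m V0^T) s).
Proof.
have := @measurable_net_bad R _ (g_sigma_algebraType (noise_sets X)) k l M
  (fun w => X0 *m (\matrix_(a, b) X (phi (a, b)) w) *m V0^T) s.
apply => i j.
have mX p : measurable_fun setT (X p : g_sigma_algebraType (noise_sets X) -> R).
  move=> _ B mB; rewrite setTI; apply: sub_sigma_algebra; by exists p, B.
rewrite (_ : (fun w => _) =
  (fun w => \sum_b (\sum_a X0 i a * X (phi (a, b)) w) * V0 j b)); last first.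
  apply/funext => w; rewrite mxE; apply: eq_bigr => b _; rewrite !mxE.
  by congr (_ * _); apply: eq_bigr => a _; rewrite mxE.
apply: measurable_sum => b; apply: measurable_funM => //.
by apply: measurable_sum => a; exact: measurable_funM.
Qed.

(** Common to the extreme matrices ([X0] and [V0] identities, [S' = S]) and to the compressed middle
    one. In both cases [S] fixes the mesh, so that [eps * S'] is at most [N / 4]: of the slack
    [N / 2] in the hypothesis on [S'], the exponent keeps [N / 4]. *)
Lemma compression_event (C : R) (I : eqType) (X : I -> {RV P >-> R}) (sigma_e : R)
    k l m q (phi : 'I_m * 'I_q -> I) (X0 : 'M[R]_(k, m)) (V0 : 'M[R]_(l, q))
    (N : nat) (t S S' : R) :
  tail_const C -> 0 < sigma_e -> iid_normal sigma_e X -> injective phi ->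
  X0 *m X0^T = 1%:M -> V0 *m V0^T = 1%:M -> (0 < l)%N ->
  (4 <= N)%N -> (k <= N)%N -> 0 <= t ->
  S = (t + 3 * N%:R + 2 * Num.sqrt N%:R) / 2 ->
  0 <= S' -> S' <= S -> Num.sqrt l%:R + t / 2 + N%:R / 2 <= S' ->
  exists B : set Omega, [/\ <<s noise_sets X >> B,
    (P B <= (C * expR (- (8^-1 * t ^+ 2)))%:E)%E &
    forall w, ~ B w -> forall y,
      nrm (y *m (X0 *m (\matrix_(a, b) X (phi (a, b)) w) *m V0^T)) <= sigma_e * S' * nrm y].
Proof.
move=> hC se0 iidX iphi oX oV l0 N4 kN t0 eS S'0 S'S hS'.
pose M := (Num.truncn (4 * S)).+1.
pose eps : R := Num.sqrt k%:R / M%:R.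
have NR : 4 <= N%:R :> R by rewrite (ler_nat _ 4).
have sN0 : 0 <= Num.sqrt N%:R :> R by exact: sqrtr_ge0.
have sN : Num.sqrt N%:R <= N%:R :> R.
  rewrite -{2}(@sqr_sqrtr R N%:R)// expr2 ler_peMl//.
  by rewrite -(ler_pXn2r (n := 2)) ?nnegrE// expr1n sqr_sqrtr//; lra.
have SN : N%:R <= S by rewrite eS; lra.
have S0 : 0 < S by lra.
have SM : 4 * S <= M%:R.
  have /andP[_ h] := truncn_itv (mulr_ge0 (ler0n R 4) (ltW S0)).
  exact: ltW.
have M0 : 0 < M%:R :> R by rewrite ltr0n.
have skN : Num.sqrt k%:R <= N%:R :> R.
  by apply: le_trans sN; rewrite ler_sqrt// ler_nat.
have epsS : eps * S <= N%:R / 4.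
  rewrite /eps mulrAC ler_pdivrMr//.
  apply: (@le_trans _ _ (N%:R * S)); first by rewrite ler_wpM2r// ltW.
  by rewrite -mulrA ler_wpM2l//; lra.
have eps0 : 0 <= eps by rewrite divr_ge0 ?sqrtr_ge0// ltW.
have eps1 : eps < 1.
  rewrite ltr_pdivrMr// mul1r; apply: (le_lt_trans skN).
  by apply: lt_le_trans SM; lra.
pose s := (1 - eps) * S'.
have epsS' : eps * S' <= N%:R / 4.
  by apply: le_trans epsS; rewrite ler_wpM2l.
have hs : t / 2 + N%:R / 4 <= s - Num.sqrt l%:R by rewrite /s; lra.
exists (net_bad M (fun w => X0 *m (\matrix_(a, b) X (phi (a, b)) w) *m V0^T) (sigma_e * s)).
split.
- exact: noise_sets_net_bad.
- apply: le_trans (gaussian_net _ se0 iidX iphi oX oV l0 _) _; first by lra.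
  by rewrite lee_fin; apply: (hC N k t S).
- move=> w nb; apply: (net_badP _ _ _ _ nb) => //.
  + by rewrite mulr_ge0// ltW.
  + by rewrite /s mulrCA.
Qed.

Lemma call_event (C : R) (D : nat) (hd : (0 < D)%N) (tau : 'S_D) (r n : 'I_D -> nat)
    (Rk : nat) (u : tt_cores R r n tau) (sigma sigma_e Tr : R)
    (noise : nat * mindex n -> {RV P >-> R}) (k : nat) (y0 : mindex n)
    (o1 m o2 : 'I_D) :
  tail_const C -> 0 < C ->
  (2 <= Rk)%N -> (forall j : 'I_D, val j = 0%N -> r j = 1%N) ->
  (forall j : 'I_D, (0 < j)%N -> (r j < Rk ^ 2)%N) ->
  (forall j, (0 < n j)%N) ->
  0 < sigma ->
  (forall (i1 i2 i3 : 'I_D) (y : mindex n), correct_order tau i1 i2 i3 ->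
     sigma <= singular_value (Rk ^ 2) (M2_13 (tt_entry hd u) y i1 i2 i3)) ->
  0 < sigma_e -> iid_normal sigma_e noise -> Tr < sigma / sigma_e ->
  let N := (\max_(i < D) n i)%N in
  let t := Tr - 2 * N%:R - 2 * Num.sqrt N%:R in
  0 <= t ->
  correct_order tau o1 m o2 ->
  exists B : set Omega, [/\ <<s noise_sets noise >> B,
    (P B <= (3 * (C * expR (- (8^-1 * t ^+ 2))))%:E)%E &
    forall w, ~ B w ->
      let Tn := fun x => tt_entry hd u x + noise (k, x) w in
      singular_value (Rk ^ 2) (M2_13 Tn y0 m o1 o2) <
        singular_value (Rk ^ 2) (M2_13 Tn y0 o1 m o2) /\
      singular_value (Rk ^ 2) (M2_13 Tn y0 o1 o2 m) <
        singular_value (Rk ^ 2) (M2_13 Tn y0 o1 m o2)].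
Proof.
move=> hC C0 R2 r1 rK npos s0 hsig se0 iidX hTr N t t0 co.
pose K := (Rk ^ 2)%N.
have K0 : (0 < K)%N by rewrite expn_gt0 (ltnW R2).
have ne (i j : 'I_D) : ((tau^-1 i)%g < (tau^-1 j)%g)%N -> i != j.
  by apply: contraTneq => ->; rewrite ltnn.
have [d1 d2 d3] : [/\ o1 != m, m != o2 & o1 != o2].
  case/orP: co => /andP[h1 h2].
    by split; [exact: ne|exact: ne|exact: ne (ltn_trans h1 h2)].
  by split; rewrite eq_sym; [exact: ne|exact: ne|exact: ne (ltn_trans h1 h2)].
have nN j : (n j <= N)%N by exact: leq_bigmax.
have Km : (K <= n m)%N.
  (* With fewer than [K] rows the [K]-th singular value would be the default 0, against
     [0 < sigma]. *)
  rewrite leqNgt; apply/negP => mk; have := hsig _ _ _ y0 co.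
  by rewrite singular_value_default; [rewrite leNgt s0|move: mk; rewrite -/K; clear; lia].
have N4 : (4 <= N)%N.
  apply: leq_trans (leq_trans Km (nN m)).
  by rewrite /K -[4%N]/(2 ^ 2)%N leq_exp2r.
have NR : 4 <= N%:R :> R by rewrite (ler_nat _ 4).
have sN0 : 0 <= Num.sqrt N%:R :> R by exact: sqrtr_ge0.
(* [S + S' = Tr] and [S - S' = N]. An extreme matrix has at most [N ^ 2] columns, so [S] beats
   [N + t / 2] by [N / 2 + sqrt N]; the compression has [K <= N] columns, so [S'] beats
   [sqrt N + t / 2] by exactly [N / 2]. *)
pose S := (t + 3 * N%:R + 2 * Num.sqrt N%:R) / 2.
pose S' := (t + N%:R + 2 * Num.sqrt N%:R) / 2.
have SS' : S + S' = Tr by rewrite /S /S' /t; lra.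
have sq (a b : nat) : (a <= N)%N -> (b <= N)%N -> Num.sqrt (a * b)%:R <= N%:R :> R.
  move=> aN bN; rewrite -[leRHS]ger0_norm// -sqrtr_sqr ler_sqrt ?sqr_ge0//.
  by rewrite -natrX ler_nat -mulnn leq_mul.
have noiseE w i1 i2 i3 : M2_13 (fun x => tt_entry hd u x + noise (k, x) w) y0 i1 i2 i3 =
  M2_13 (tt_entry hd u) y0 i1 i2 i3 + M2_13 (fun x => noise (k, x) w) y0 i1 i2 i3.
  exact: M2_13D.
have inj_phi A (psi : A -> mindex n) : injective psi -> injective (fun p => (k, psi p)).
  by move=> h p p' [/h].
have extreme i1 i2 i3 : i1 != i2 -> i1 != i3 -> i2 != i3 ->
    (\rank (M2_13 (tt_entry hd u) y0 i1 i2 i3) < K)%N ->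
  exists B : set Omega, [/\ <<s noise_sets noise >> B,
    (P B <= (C * expR (- (8^-1 * t ^+ 2)))%:E)%E &
    forall w, ~ B w -> singular_value K
      (M2_13 (fun x => tt_entry hd u x + noise (k, x) w) y0 i1 i2 i3) <= sigma_e * S].
  move=> i12 i13 i23 rk.
  have [psi [ipsi psiE]] := M2_13_entries R y0 i12 i13 i23.
  have o (p : nat) : (1%:M : 'M[R]_p) *m 1%:M^T = 1%:M by rewrite trmx1 mulmx1.
  have l0 : (0 < n i1 * n i3)%N by rewrite muln_gt0 !npos.
  have S0 : 0 <= S by rewrite /S; lra.
  have hS : Num.sqrt (n i1 * n i3)%:R + t / 2 + N%:R / 2 <= S.
    by have := sq _ _ (nN i1) (nN i3); rewrite /S; lra.
  have [B [sB PB hB]] := compression_event hC se0 iidX (inj_phi _ _ ipsi)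
    (o (n i2)) (o (n i1 * n i3)%N) l0 N4 (nN _) t0 erefl S0 (lexx S) hS.
  exists B; split => // w nB; rewrite noiseE; apply: singular_value_low_rank => //.
    by rewrite mulr_ge0 ?(ltW se0)// /S; lra.
  move=> y; have := hB w nB y; rewrite psiE trmx1 mul1mx mulmx1; exact.
have rank_ext i1 i2 i3 : i1 != i3 ->
    ((tau^-1 i2)%g < (tau^-1 i1)%g)%N && ((tau^-1 i2)%g < (tau^-1 i3)%g)%N ||
    ((tau^-1 i1)%g < (tau^-1 i2)%g)%N && ((tau^-1 i3)%g < (tau^-1 i2)%g)%N ->
    (\rank (M2_13 (tt_entry hd u) y0 i1 i2 i3) < K)%N.
  move=> i13 /orP[/andP[h1 h2]|/andP[h1 h2]].
    exact: (mxrank_tt_first hd u r1 rK).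
  exact: (mxrank_tt_last hd u r1 rK).
have [B1 [sB1 PB1 hB1]] : exists B : set Omega, [/\ <<s noise_sets noise >> B,
    (P B <= (C * expR (- (8^-1 * t ^+ 2)))%:E)%E &
    forall w, ~ B w -> singular_value K
      (M2_13 (fun x => tt_entry hd u x + noise (k, x) w) y0 m o1 o2) <= sigma_e * S].
  apply: extreme => //; first by rewrite eq_sym.
  apply: rank_ext => //; case/orP: co => /andP[h1 h2].
    by rewrite h1 (ltn_trans h1 h2).
  by rewrite h2 (ltn_trans h1 h2) orbT.
have [B2 [sB2 PB2 hB2]] : exists B : set Omega, [/\ <<s noise_sets noise >> B,
    (P B <= (C * expR (- (8^-1 * t ^+ 2)))%:E)%E &
    forall w, ~ B w -> singular_value K
      (M2_13 (fun x => tt_entry hd u x + noise (k, x) w) y0 o1 o2 m) <= sigma_e * S].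
  apply: extreme => //; first by rewrite eq_sym.
  apply: rank_ext => //; case/orP: co => /andP[h1 h2].
    by rewrite h2 (ltn_trans h1 h2) orbT.
  by rewrite h1 (ltn_trans h1 h2).
have [B3 [sB3 PB3 hB3]] : exists B : set Omega, [/\ <<s noise_sets noise >> B,
    (P B <= (C * expR (- (8^-1 * t ^+ 2)))%:E)%E &
    forall w, ~ B w -> sigma - sigma_e * S' <= singular_value K
      (M2_13 (fun x => tt_entry hd u x + noise (k, x) w) y0 o1 m o2)].
  have [X [V [oX oV hXV]]] := singular_value_compression K0 s0 (hsig _ _ _ y0 co).
  have [psi [ipsi psiE]] := M2_13_entries R y0 d1 d3 d2.
  have KN : (K <= N)%N by exact: leq_trans Km (nN m).
  have sK : Num.sqrt K%:R <= Num.sqrt N%:R :> R by rewrite ler_sqrt// ler_nat.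
  have S'0 : 0 <= S' by rewrite /S'; lra.
  have S'S : S' <= S by rewrite /S' /S; lra.
  have hS' : Num.sqrt K%:R + t / 2 + N%:R / 2 <= S' by rewrite /S'; lra.
  have [B [sB PB hB]] := compression_event hC se0 iidX (inj_phi _ _ ipsi)
    oX oV K0 N4 KN t0 erefl S'0 S'S hS'.
  exists B; split => // w nB; rewrite noiseE; apply: hXV.
    by rewrite mulr_ge0 ?(ltW se0)// /S'; lra.
  by move=> y; have := hB w nB y; rewrite psiE.
exists (B1 `|` B2 `|` B3); split.
- apply: (@measurableU _ (g_sigma_algebraType (noise_sets noise))) => //.
  exact: (@measurableU _ (g_sigma_algebraType (noise_sets noise))).
- have mB1 := measurable_noise_sets sB1; have mB2 := measurable_noise_sets sB2.
  have mB3 := measurable_noise_sets sB3.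
  apply: le_trans (measureU2 _ _ _) _ => //; first exact: measurableU.
  set c := C * _ in PB1 PB2 PB3 *.
  have -> : 3 * c = (c + c) + c by ring.
  rewrite 2!EFinD; apply: leeD => //; apply: le_trans (measureU2 _ _ _) _ => //.
  exact: leeD.
move=> w nB /=; have n1 : ~ B1 w by move=> h; apply: nB; left; left.
have n2 : ~ B2 w by move=> h; apply: nB; left; right.
have n3 : ~ B3 w by move=> h; apply: nB; right.
(* Equivalent to [sigma_e * Tr < sigma]: the extreme values stay below the middle one. *)
have h : sigma_e * S < sigma - sigma_e * S'.
  rewrite ltrBrDr -mulrDr SS' mulrC -ltr_pdivlMr//.
split; first exact: le_lt_trans (hB1 w n1) (lt_le_trans h (hB3 w n3)).
exact: le_lt_trans (hB2 w n2) (lt_le_trans h (hB3 w n3)).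
Qed.

End CallEvent.

(** * Conditioning on the sampled coordinates *)

Section ThreeIndexError.
Context (R : realType) disp (Omega : measurableType disp) (P : probability Omega R).

Lemma fin_partition_bound (F : finType) (Y : Omega -> F) (A : F -> set Omega) (c : R) :
  (forall f, measurable (Y @^-1` [set f])) -> (forall f, measurable (A f)) ->
  (forall f, P (Y @^-1` [set f] `&` A f) = (P (Y @^-1` [set f]) * P (A f))%E) ->
  (forall f, (P (A f) <= c%:E)%E) -> 0 <= c ->
  measurable (\bigcup_f (Y @^-1` [set f] `&` A f)) /\
  (P (\bigcup_f (Y @^-1` [set f] `&` A f)) <= c%:E)%E.
Proof.
move=> mY mA ind hA c0.
have mF f : measurable (Y @^-1` [set f] `&` A f) by exact: measurableI.
have fT : finite_set [set: F] by exact: finite_finset.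
split; first by apply: fin_bigcup_measurable.
have tY : trivIset [set: F] (fun f => Y @^-1` [set f]).
  by move=> f g _ _ [w [/= -> ->]].
have tF : trivIset [set: F] (fun f => Y @^-1` [set f] `&` A f).
  by move=> f g _ _ [w [[/= <- _] [<- _]]].
rewrite measure_fin_bigcup//.
apply: (@le_trans _ _ (\sum_(f \in [set: F]) (P (Y @^-1` [set f]) * c%:E))%E).
  apply: lee_fsum => // f _ /=; rewrite ind; apply: lee_wpmul2l => //.
rewrite -ge0_mule_fsuml => [|f]; last exact: measure_ge0.
rewrite -measure_fin_bigcup//.
rewrite -[leRHS]mul1e; apply: lee_wpmul2r; first by rewrite lee_fin.
by apply: probability_le1; apply: fin_bigcup_measurable.
Qed.

Lemma three_index_event (C : R) (D : nat) (hd : (0 < D)%N) (tau : 'S_D) (r n : 'I_D -> nat)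
    (Rk : nat) (u : tt_cores R r n tau) (sigma sigma_e Tr : R)
    (noise : nat * mindex n -> {RV P >-> R})
    (y : nat * ('I_D * 'I_D * 'I_D) -> Omega -> mindex n)
    (v : nat * ('I_D * 'I_D * 'I_D)) :
  tail_const C -> 0 < C ->
  (2 <= Rk)%N -> (forall j : 'I_D, val j = 0%N -> r j = 1%N) ->
  (forall j : 'I_D, (0 < j)%N -> (r j < Rk ^ 2)%N) ->
  (forall j, (0 < n j)%N) ->
  0 < sigma ->
  (forall (i1 i2 i3 : 'I_D) (y : mindex n), correct_order tau i1 i2 i3 ->
     sigma <= singular_value (Rk ^ 2) (M2_13 (tt_entry hd u) y i1 i2 i3)) ->
  0 < sigma_e -> iid_normal sigma_e noise -> independent_of_noise noise y ->
  Tr < sigma / sigma_e ->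
  let N := (\max_(i < D) n i)%N in
  let t := Tr - 2 * N%:R - 2 * Num.sqrt N%:R in
  0 <= t ->
  exists B : set Omega, [/\ measurable B,
    (P B <= (3 * (C * expR (- (8^-1 * t ^+ 2))))%:E)%E &
    distinct3 v.2 -> forall w, ~ B w ->
      agrees (fun k i1 i2 i3 =>
        three_index Rk (fun x => tt_entry hd u x + noise (k, x) w)
          (y (k, (i1, i2, i3)) w) i1 i2 i3) (fun i => val ((tau^-1)%g i)) v].
Proof.
move=> hC C0 R2 r1 rK npos s0 hsig se0 iidX [mY indY] hTr N t t0.
set c := 3 * _.
have c0 : 0 <= c by rewrite mulr_ge0// mulr_ge0 ?expR_ge0// ltW.
(* An event is supplied for every query, empty when indices coincide, so that a choice function on
   all queries can be taken later. *)
have [dv|ndv] := boolP (distinct3 v.2); last first.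
  by exists set0; split => //; rewrite measure0 lee_fin.
case: v dv => k [[i1 i2] i3] /and3P[/= d12 d13 d23].
pose p i := val ((tau^-1)%g i).
have fixed (y0 : mindex n) : exists B : set Omega, [/\ <<s noise_sets noise >> B,
    (P B <= c%:E)%E & forall w, ~ B w ->
      three_index Rk (fun x => tt_entry hd u x + noise (k, x) w) y0 i1 i2 i3 =
      ideal_call p i1 i2 i3].
  have ev o1 m o2 : correct_order tau o1 m o2 -> _ :=
    call_event k y0 hC C0 R2 r1 rK npos s0 hsig se0 iidX hTr t0.
  have gt_maxE (a b e : R) : a < e -> b < e -> Num.max a b < e.
    by rewrite gt_max => -> ->.
  have lt_maxF (a b e : R) : e < a \/ e < b -> (Num.max a b < e) = false.
    rewrite gt_max => -[h|h]; first by rewrite (lt_gtF h).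
    by rewrite (lt_gtF h) andbF.
  rewrite /ideal_call; case: ifPn => [c1|n1].
    have [B [sB PB hB]] := ev _ _ _ c1.
    exists B; split => // w /hB /= [h1 h2].
    rewrite /three_index (singular_value_M1_23 _ _ _ _ d12) singular_value_M2_31.
    rewrite (singular_value_M3_12 _ _ _ _ d23) (gt_maxE _ _ _ h1)//.
    by rewrite singular_value_M2_13C// eq_sym.
  case: ifPn => [c2|n2].
    have [B [sB PB hB]] := ev _ _ _ c2.
    exists B; split => // w /hB /= [h1 h2].
    rewrite /three_index (singular_value_M1_23 _ _ _ _ d12) singular_value_M2_31.
    rewrite (singular_value_M3_12 _ _ _ _ d23) lt_maxF; last by left.
    by rewrite gt_maxE.
  have c3 : correct_order tau i1 i3 i2.
    have pp i j : i != j -> p i != p j.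
      by apply: contraNneq => /val_inj/perm_inj ->.
    have := pp _ _ d12; have := pp _ _ d13; have := pp _ _ d23.
    move: n1 n2; rewrite /between /correct_order -/(p i1) -/(p i2) -/(p i3).
    by clear; lia.
  have [B [sB PB hB]] := ev _ _ _ c3.
  exists B; split => // w /hB /= [h1 h2].
  rewrite /three_index (singular_value_M1_23 _ _ _ _ d12) singular_value_M2_31.
  rewrite (singular_value_M3_12 _ _ _ _ d23).
  have h1' : singular_value (Rk ^ 2)
      (M2_13 (fun x => tt_entry hd u x + noise (k, x) w) y0 i2 i1 i3) <
    singular_value (Rk ^ 2) (M2_13 (fun x => tt_entry hd u x + noise (k, x) w) y0 i1 i3 i2).
    by rewrite singular_value_M2_13C// eq_sym.
  rewrite lt_maxF; last by right.
  rewrite lt_maxF; last by right.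
  by rewrite gt_maxE.
have [Bf hBf] := choice fixed.
have [|||||mB PB] := @fin_partition_bound _ (y (k, (i1, i2, i3))) Bf c.
- by move=> f; exact: mY.
- move=> f; have [h _ _] := hBf f; exact: measurable_noise_sets h.
- move=> f; have [h _ _] := hBf f; apply: indY => //.
  by apply: sub_sigma_algebra; exists (k, (i1, i2, i3)), f.
- by move=> f; have [_ h _] := hBf f.
- exact: c0.
exists (\bigcup_f (y (k, (i1, i2, i3)) @^-1` [set f] `&` Bf f)); split => // _ w nB.
rewrite /agrees /=; have [_ _] := hBf (y (k, (i1, i2, i3)) w); apply.
by move=> h; apply: nB; exists (y (k, (i1, i2, i3)) w).
Qed.

End ThreeIndexError.

Section CallCount.
Variable R : realType.

(** With [c] the rounded-up binary logarithm, each of [1], [d] and [(c - 1) * d] is at most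
    [d * ln d / ln 2]; hence the factor 3. *)
Lemma up_log_ln (d : nat) : (3 <= d)%N ->
  (1 + up_log 2 d * d)%N%:R <= 3 / ln 2 * (d%:R * ln d%:R) :> R.
Proof.
move=> d3; pose L : R := ln 2.
have L0 : 0 < L by rewrite ln_gt0// ltr1n.
have dR : 3 <= d%:R :> R by rewrite (ler_nat _ 3).
have d1 : (1 < d)%N by exact: leq_trans d3.
have /andP[h _] := up_log_bounds (isT : (1 < 2)%N) d1.
set c := up_log 2 d in h *.
have c1 : (0 < c)%N by rewrite up_log_gt0 ?d1.
have hL : c.-1%:R * L <= ln d%:R.
  rewrite mulr_natl -lnXn// -natrX ler_ln ?posrE ?ltr0n ?expn_gt0 ?(ltnW d1)//.
  by rewrite ler_nat ltnW.
have lL : L <= ln d%:R by rewrite ler_ln ?posrE ?ltr0n ?(ltnW d1)// ler_nat.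
have cE : c%:R = c.-1%:R + 1 :> R by rewrite natr1 prednK.
rewrite natrD natrM cE mulrAC ler_pdivlMr// -/L.
have h1 : d%:R * (c.-1%:R * L) <= d%:R * ln d%:R :> R by rewrite ler_wpM2l.
have h2 : d%:R * L <= d%:R * ln d%:R :> R by rewrite ler_wpM2l.
have h3 : L <= d%:R * L by rewrite ler_peMl ?(ltW L0)//; lra.
lra.
Qed.

End CallCount.

Theorem corollary4p17 (R : realType) :
  exists C : R,
  forall (d : nat) (hd : (3 <= d)%N) (tau : 'S_d)
    (r n : 'I_d -> nat) (Rk : nat),
  (0 < Rk)%N ->
  (forall j : 'I_d, val j = 0%N -> r j = 1%N) ->
  (forall j : 'I_d, val j = 0%N \/ val j = d.-1 -> (Rk <= n (tau j))%N) ->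
  (forall j : 'I_d, (0 < j < d.-1)%N -> (Rk ^ 2 <= n (tau j))%N) ->
  (forall j : 'I_d, (0 < j)%N -> (Rk <= r j < Rk ^ 2)%N) ->
  forall (u : tt_cores R r n tau) (sigma sigma_e : R),
  0 < sigma ->
  (forall (i1 i2 i3 : 'I_d) (y : mindex n), correct_order tau i1 i2 i3 ->
     sigma <= singular_value (Rk ^ 2)
                (M2_13 (tt_entry (ltnW (ltnW hd)) u) y i1 i2 i3)) ->
  0 < sigma_e ->
  forall (disp : measure_display) (Omega : measurableType disp)
    (P : probability Omega R)
    (noise : nat * mindex n -> {RV P >-> R})
    (y : nat * ('I_d * 'I_d * 'I_d) -> Omega -> mindex n),
  iid_normal sigma_e noise ->
  independent_of_noise noise y ->
  forall T : R, T < sigma / sigma_e ->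
  let nmax : R := (\max_(i < d) n i)%N%:R in
  (P [set w | incorrect tau
                (noisy_recovery Rk (tt_entry (ltnW (ltnW hd)) u) noise y w)] <=
   (C * d%:R * ln d%:R *
    expR (- (8%:R^-1 *
             Num.max (T - 2%:R * nmax - 2%:R * Num.sqrt nmax) 0 ^+ 2)))%:E)%E.
Proof.
have [C0 C0gt hC] := tail_numeric R.
pose L : R := ln 2.
have L0 : 0 < L by rewrite ln_gt0// ltr1n.
(* [3 / L] comes from the number of calls and the other 3 from the matrices of a call; the [+ 1]
   makes the bound at least 1 when the maximum in the exponent is 0. *)
exists (3 / L * (3 * (C0 + 1))).
move=> d hd tau r n Rk Rk0 r1 nend nmid rK u sigma sigma_e s0 hsig se0
  disp Omega P noise y iidX indY T hT; cbv zeta.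
set nmax : R := (\max_(i < d) n i)%N%:R.
have hd0 := ltnW (ltnW hd).
have dpos : 0 < d%:R :> R by rewrite ltr0n.
(* No bond size satisfies [1 <= r < 1], and [d >= 3] provides a bond at position 1. *)
have R2 : (2 <= Rk)%N.
  have := rK (Ordinal (ltnW hd)) isT.
  by case: (Rk) Rk0 => [|[|]]//= _ /andP[h1 h2]; have := leq_ltn_trans h1 h2.
have npos j : (0 < n j)%N.
  rewrite -(permKV tau j); set i := (tau^-1)%g j.
  have [i0|i0] := posnP i; first by apply: leq_trans Rk0 (nend _ (or_introl i0)).
  have [ilt|ige] := ltnP i d.-1.
    by apply: leq_trans (nmid i _); rewrite ?expn_gt0 ?Rk0// i0.
  apply: leq_trans Rk0 (nend _ (or_intror _)).
  by apply/eqP; rewrite eqn_leq ige andbT -ltnS prednK// ltn_ord.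
have rK' (j : 'I_d) : (0 < j)%N -> (r j < Rk ^ 2)%N by move=> /rK /andP[].
pose call w k i1 i2 i3 :=
  three_index Rk (fun x => tt_entry (ltnW (ltnW hd)) u x + noise (k, x) w)
      (y (k, (i1, i2, i3)) w) i1 i2 i3.
have mrec : discrete_rv (fun w =>
    noisy_recovery Rk (tt_entry (ltnW (ltnW hd)) u) noise y w).
  apply: (@discrete_train_recovery _ _ _ call) => k i1 i2 i3.
  apply: (@discrete_bind _ _ _ _ (y (k, (i1, i2, i3)))
    (fun y0 w => three_index Rk
      (fun x => tt_entry (ltnW (ltnW hd)) u x + noise (k, x) w) y0 i1 i2 i3)).
    by apply: discrete_finType => y0; exact: indY.1.
  move=> y0; apply: discrete_three_index => // x.
  exact: measurable_funD.
have minc := mrec [set o | incorrect tau o].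
have big : 1 <= 3 / L * (d%:R * ln d%:R) :> R.
  by apply: le_trans (up_log_ln R hd); rewrite (ler_nat _ 1).
have [t0|t0] := leP 0 (T - 2%:R * nmax - 2%:R * Num.sqrt nmax); last first.
  apply: le_trans (probability_le1 _ minc) _.
  rewrite expr0n/= mulr0 oppr0 expR0 mulr1 lee_fin.
  have -> : 3 / L * (3 * (C0 + 1)) * d%:R * ln d%:R =
    (3 / L * (d%:R * ln d%:R)) * (3 * (C0 + 1)) by ring.
  rewrite -[leLHS]mulr1; apply: ler_pM => //; lra.
set E := expR _.
have E0 : 0 <= E by exact: expR_ge0.
have [V [sV dV HV]] := train_recovery_correct tau hd (up_logP d (isT : (1 < 2)%N)).
have ev v := three_index_event v hC C0gt R2 r1 rK' npos s0 hsig se0 iidX indY hT t0.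
have [B hB] := choice ev.
set c := 3 * (C0 * E).
have mB v : measurable (B v) by have [] := hB v.
have PB v : (P (B v) <= c%:E)%E by have [] := hB v.
apply: (@le_trans _ _ (P (\big[setU/set0]_(v <- V) B v))).
  apply: le_measure; rewrite ?inE//; first exact: bigsetU_measurable.
  (* Outside the bad events of the predetermined queries [V], every one of them is answered ideally,
     which forces a correct output of the adaptive run. *)
  move=> w /=; rewrite /noisy_recovery => hw; apply: contrapT => nB.
  have [|tau' e tC] := HV (call w).
    move=> v vV; have [_ _ h] := hB v; apply: h; first exact: (allP dV).
    by move=> Bw; apply: nB; rewrite (big_rem v)//=; left.
  by move: hw; rewrite e/= tC.
have c0 : 0 <= c by rewrite /c !mulr_ge0// ltW.
apply: le_trans (union_bound V c0 (fun v _ => mB v) (fun v _ => PB v)) _.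
rewrite lee_fin; apply: (@le_trans _ _ ((1 + up_log 2 d * d)%N%:R * c)).
  by rewrite ler_wpM2r ?ler_nat// /c !mulr_ge0// ltW.
apply: (@le_trans _ _ (3 / L * (d%:R * ln d%:R) * c)).
  by rewrite ler_wpM2r ?up_log_ln// /c !mulr_ge0// ltW.
have -> : 3 / L * (3 * (C0 + 1)) * d%:R * ln d%:R * E =
    (3 / L * (d%:R * ln d%:R)) * (3 * ((C0 + 1) * E)) by ring.
rewrite ler_wpM2l//; first exact: le_trans big.
by rewrite /c ler_pM2l// ler_wpM2r// lerDl.
Qed.
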